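(* Let $\alpha_1,\alpha_2 \ge 0$. For $j\in\{1,2\}$ let $F_j$ be the distribution function of a non-negative real random variable whose tail $\bar F_j = 1-F_j$ is regularly varying at $\infty$ with index $-\alpha_j$, let $(X^{(j)}_i)_{i\ge 1}$ be i.i.d. random variables with distribution $F_j$, and for $n \ge 1$ put $R_{\alpha_j,n} = \big(\sum_{i=1}^n X^{(j)}_i\big)/\max_{1\le i\le n} X^{(j)}_i$. If $\alpha_1 \le \alpha_2$, then $R_{\alpha_1,n}$ is smaller than $R_{\alpha_2,n}$ in Laplace transform order as $n \to \infty$; that is, for every real $s>0$, $$\lim_{n\to\infty} \mathbb{E}\big(e^{-sR_{\alpha_1,n}}\big) \;\ge\; \lim_{n\to\infty} \mathbb{E}\big(e^{-sR_{\alpha_2,n}}\big),$$ where both limits exist.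
   Context: A positive, Lebesgue measurable function $h$ on $(0,\infty)$ is regularly varying at $\infty$ with index $\rho\in\mathbb{R}$ if $\lim_{x\to\infty} h(tx)/h(x) = t^{\rho}$ for every constant $0<t<\infty$ (index $0$ is called slowly varying). For random variables $U,V$, $U$ is said to be smaller than $V$ in Laplace transform order if $\mathbb{E}(e^{-sU}) \ge \mathbb{E}(e^{-sV})$ for all real $s>0$. Convention: on the event that the maximum equals $0$, the ratio $R_{\alpha_j,n}$ is set equal to $1$. *)

(* Defs.v *)
From HB Require Import structures.
From mathcomp Require Import all_boot all_order all_algebra finmap.
From mathcomp Require Import all_classical all_reals all_analysis.
Set Implicit Arguments.
Unset Strict Implicit.
Unset Printing Implicit Defensive.
Import Order.TTheory GRing.Theory Num.Theory.
Import numFieldNormedType.Exports.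
Local Open Scope classical_set_scope.
Local Open Scope ring_scope.

(* [measurable_fun] on [R] itself refers to Borel sets; here the domain carries
   the Caratheodory sigma-algebra of the Lebesgue outer measure. *)
Definition lebesgue_measurable_fun (R : realType) (D : set R) (h : R -> R) :=
  @measurable_fun _ _ (caratheodory_type ((@wlength R idfun)^*)%mu) R D h.

Definition regularly_varying (R : realType) (rho : R) (h : R -> R) :=
  [/\ forall x, 0 < x -> 0 < h x,
      lebesgue_measurable_fun `]0, +oo[ h &
      forall t, 0 < t -> h (t * x) / h x @[x --> +oo] --> t `^ rho].

(* [cdf] takes its values in [\bar R]. *)
Definition has_cdf d (T : measurableType d) (R : realType)
    (P : probability T R) (X : {RV P >-> R}) (F : R -> R) :=
  forall r, cdf X r = (F r)%:E.

(* The variable of which F is the distribution function may live on any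
   probability space. *)
Definition nonneg_rv_cdf (R : realType) (F : R -> R) :=
  exists (d : measure_display) (T : measurableType d) (P : probability T R)
    (Y : {RV P >-> R}), (forall w, 0 <= Y w) /\ has_cdf Y F.

Definition mutually_independent d (T : measurableType d) (R : realType)
    (P : probability T R) (X : nat -> {RV P >-> R}) :=
  forall (J : {fset nat}) (B : nat -> set R),
    (forall i : nat, i \in J -> measurable (B i)) ->
    P (\bigcap_(i in [set` J]) (X i @^-1` B i)) =
      (\prod_(i <- J) P (X i @^-1` B i))%E.

Definition iid_with_cdf d (T : measurableType d) (R : realType)
    (P : probability T R) (X : nat -> {RV P >-> R}) (F : R -> R) :=
  mutually_independent X /\ forall i, has_cdf (X i) F.

(* The sequence is indexed from 0. *)
Definition partial_sum d (T : measurableType d) (R : realType)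
    (P : probability T R) (X : nat -> {RV P >-> R}) (n : nat) (w : T) : R :=
  \sum_(i < n) X i w.

(* Seeding the iterated maximum with [X 0 w] gives the actual maximum of the
   first n terms for n >= 1, whatever their signs. *)
Definition partial_max d (T : measurableType d) (R : realType)
    (P : probability T R) (X : nat -> {RV P >-> R}) (n : nat) (w : T) : R :=
  \big[Num.max/X 0%N w]_(i < n) X i w.

Definition sum_max_ratio d (T : measurableType d) (R : realType)
    (P : probability T R) (X : nat -> {RV P >-> R}) (n : nat) (w : T) : R :=
  if partial_max X n w == 0 then 1 else partial_sum X n w / partial_max X n w.

Definition laplace d (T : measurableType d) (R : realType)
    (P : probability T R) (U : T -> R) (s : R) : \bar R :=
  ('E_P[(fun w => expR (- s * U w))])%E.

(* Main.v *)
Require Import Defs.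
From HB Require Import structures.
From mathcomp Require Import all_boot all_order all_algebra finmap.
From mathcomp Require Import all_classical all_reals all_analysis.
From mathcomp Require Import measurable_realfun zify ring lra.
Import Order.TTheory GRing.Theory Num.Theory.
Import numFieldNormedType.Exports.
Local Open Scope classical_set_scope.
Local Open Scope ring_scope.
Set Implicit Arguments.
Unset Strict Implicit.
Unset Printing Implicit Defensive.

(* Writing G for the tail 1 - F, both limits are computed: they equal
   e^-s / H(alpha), where H(alpha) is the integral over r in ]0, 1[ of
   level s r `^ (- alpha) and level s r = min(1, - ln (1 - r) / s). As
   0 < level s r <= 1, H is nondecreasing in alpha.

   Let g_c(y) = e^(- s y / c) 1_{y <= c} and phi(c) = E g_c(X). Cutting the
   range of the maximum along the grid b_k = lambda^k, the independence of
   the X_i squeezes E e^(-s R_n), up to negligible terms, between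
     n e^-s sum_k (G(b_k) - G(b_k+1)) phi(b_k)^(n-1)   and
     n e^-s sum_k (G(b_k) - G(b_k+1)) phi(b_k+1)^(n-1);
   freezing the value of the maximum only at grid points means that neither a
   density nor a joint law is needed, and atoms of F do no harm.
   The layer-cake formula gives 1 - phi(c) = \int_0^1 G(c * level s r) dr, so
   that (1 - phi(b_k)) / G(b_k) --> H(alpha), by dominated convergence (Potter
   bound) if alpha < 1, and by Fatou with H(alpha) = +oo otherwise. Replacing
   phi(b_k) by 1 - H G(b_k), the sums telescope, up to a factor
   G(b_k) / G(b_k+1) --> lambda^alpha, to 1 / H; finally lambda tends to 1. *)

(** * Product formula for expectations under independence *)

Section independence.
Import HBNNSimple.
Context d (T : measurableType d) (R : realType) (P : probability T R).

(** Both sides are additive in [h] and continuous along increasing sequences, so the identity passes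
    from indicators to simple functions and then, by monotone convergence, to [h]. *)
Lemma ge0_integral_mul_indic_ext (Z : T -> R) (Y : {RV P >-> R}) (c : R)
    (h : R -> R) :
    measurable_fun setT Z -> (forall w, 0 <= Z w) -> 0 <= c ->
    (forall B, measurable B ->
      (\int[P]_w (Z w * \1_B (Y w))%:E = c%:E * P (Y @^-1` B))%E) ->
    measurable_fun setT h -> (forall y, 0 <= h y) ->
  (\int[P]_w (Z w * h (Y w))%:E = c%:E * \int[P]_w (h (Y w))%:E)%E.
Proof.
move=> mZ Z0 c0 ZB mh h0.
have mh' : measurable_fun [set: R] (EFin \o h) by exact/measurable_EFinP.
pose g := nnsfun_approx measurableT mh'.
have g_cvg y : (g n y)%:E @[n --> \oo] --> (h y)%:E.
  by apply: (cvg_nnsfun_approx measurableT mh' _ I) => y' _ /=; rewrite lee_fin.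
have g_nd y : {homo g^~ y : m n / (m <= n)%N >-> m <= n}.
  by move=> m n mn; apply/lefP/nd_nnsfun_approx.
have mgY n : measurable_fun setT (g n \o Y) by exact: measurableT_comp.
have mind B : measurable B -> measurable_fun setT (fun w => \1_B (Y w) : R).
  by move=> mB; apply: measurableT_comp => //; exact: measurable_indic.
(* A general weight [V] lets the same expansion serve twice, for [V = Z] and for [V = 1]. *)
have simple n (V : T -> R) (q : set R -> \bar R) : measurable_fun setT V ->
    (forall w, 0 <= V w) ->
    (forall B, measurable B -> (\int[P]_w (V w * \1_B (Y w))%:E = q B)%E) ->
    (\int[P]_w (V w * g n (Y w))%:E =
      \sum_(y \in range (g n)) y%:E * q (g n @^-1` [set y]))%E.
  move=> mV V0 qE.
  have mB y : measurable (g n @^-1` [set y]) by [].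
  transitivity (\int[P]_w (\sum_(y \in range (g n))
        (y * (V w * \1_(g n @^-1` [set y]) (Y w)))%:E))%E.
    apply: eq_integral => w _; rewrite fsumEFin//; congr EFin.
    rewrite {1}fimfunE mulr_fsumr; apply: eq_fsbigr => y _; ring.
  rewrite ge0_integral_fsum//.
  - apply: eq_fsbigr => y; rewrite inE => -[x _ <-].
    under eq_integral do rewrite EFinM.
    rewrite ge0_integralZl_EFin ?qE//.
    + by move=> w _; rewrite lee_fin mulr_ge0.
    + by apply/measurable_EFinP/measurable_funM => //; exact: mind.
  - move=> y; apply/measurable_EFinP/measurable_funM => //.
    by apply: measurable_funM => //; exact: mind.
  - move=> y w _; rewrite lee_fin indicE.
    case: (boolP (_ \in _)) => [|_]; last by rewrite !mulr0.
    by rewrite inE /= => <-; rewrite !mulr_ge0.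
have gE n : (\int[P]_w (Z w * g n (Y w))%:E = c%:E * \int[P]_w (g n (Y w))%:E)%E.
  rewrite (simple n Z _ mZ Z0 ZB).
  have -> : (\int[P]_w (g n (Y w))%:E =
     \sum_(y \in range (g n)) y%:E * P (Y @^-1` (g n @^-1` [set y])))%E.
    rewrite -(simple n (cst 1) (fun B => P (Y @^-1` B)))//.
    - by apply: eq_integral => w _; rewrite mul1r.
    - move=> B mB; under eq_integral do rewrite mul1r.
      have -> : (\int[P]_w (\1_B (Y w))%:E = \int[P]_w (\1_(Y @^-1` B) w)%:E)%E.
        by [].
      rewrite integral_indic// ?setIT//; exact: measurable_funPTI.
  rewrite ge0_mule_fsumr; last first.
    move=> y; have [y0|y0] := leP 0 y; first by rewrite mule_ge0// lee_fin.
    by rewrite preimage_nnfun0// preimage_set0 measure0 mule0.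
  by apply: eq_fsbigr => y _; rewrite muleCA.
have cvgV (V : T -> R) : measurable_fun setT V -> (forall w, 0 <= V w) ->
    (\int[P]_w (V w * g n (Y w))%:E)%E @[n --> \oo] -->
      (\int[P]_w (V w * h (Y w))%:E)%E.
  move=> mV V0.
  have -> : (\int[P]_w (V w * h (Y w))%:E =
      \int[P]_w limn (fun n => (V w * g n (Y w))%:E))%E.
    apply: eq_integral => w _; apply/esym/cvg_lim => //.
    under eq_fun do rewrite EFinM.
    by rewrite EFinM; apply: cvgeZl.
  apply: (@cvg_monotone_convergence _ _ _ P _ measurableT
    (fun n w => (V w * g n (Y w))%:E)).
  - by move=> n; apply/measurable_EFinP; apply: measurable_funM => //; exact: mgY.
  - by move=> n w _; rewrite lee_fin mulr_ge0.
  - by move=> w _ m n mn; rewrite lee_fin ler_wpM2l// g_nd.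
have gY : (\int[P]_w (g n (Y w))%:E)%E @[n --> \oo] --> (\int[P]_w (h (Y w))%:E)%E.
  have := cvgV (cst 1) (measurable_cst _) (fun=> ler01).
  rewrite (eq_integral (fun w => (h (Y w))%:E)) => [|w _]; last by rewrite mul1r.
  apply: cvg_trans; apply: near_eq_cvg; apply: nearW => n.
  by apply: eq_integral => w _; rewrite mul1r.
have := cvgV Z mZ Z0; under eq_fun do rewrite gE.
move=> /cvg_unique; apply => //; exact: cvgeZl.
Qed.

Lemma integral_fin_num01 (f : T -> R) : measurable_fun setT f ->
  (forall w, 0 <= f w <= 1) -> (\int[P]_w (f w)%:E)%E \is a fin_num.
Proof.
move=> mf f01; have f0 w : 0 <= f w by have /andP[] := f01 w.
rewrite ge0_fin_numE; last by apply: integral_ge0 => w _; rewrite lee_fin.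
apply: (@le_lt_trans _ _ (\int[P]_w (cst 1%E w))%E).
  apply: ge0_le_integral => //.
  - by move=> w _; rewrite lee_fin.
  - exact/measurable_EFinP.
  - by move=> w _; rewrite lee_fin; have /andP[] := f01 w.
by rewrite integral_cst// mul1e [X in (X < _)%E]probability_setT ltry.
Qed.

Variable X : nat -> {RV P >-> R}.
Hypothesis indepX : mutually_independent X.

(** The product of indicators is the indicator of the intersection, to which independence over the
    indices below [n] applies. *)
Let integral_prod_indic n (B : nat -> set R) : (forall i, measurable (B i)) ->
  (\int[P]_w (\prod_(i < n) \1_(B i) (X i w))%:E =
   \prod_(i < n) \int[P]_w (\1_(B i) (X i w))%:E)%E.
Proof.
move=> mB.
have e i : (\int[P]_w (\1_(B i) (X i w))%:E = P (X i @^-1` B i))%E.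
  rewrite -[X in P X]setIT -integral_indic//; exact: measurable_funPTI.
under [in RHS]eq_bigr do rewrite e.
have mem_J i : (i \in seq_fset tt (iota 0 n)) = (i < n)%N.
  by rewrite seq_fsetE mem_iota.
have := @indepX (seq_fset tt (iota 0 n)) B (fun i _ => mB i).
rewrite (perm_big _ (seq_fset_perm tt _)) undup_id ?iota_uniq//.
rewrite -{1}[n in RHS]subn0 -/(index_iota 0 n) big_mkord => <-.
rewrite -[X in P X]setIT -integral_indic//; last first.
  apply: fin_bigcap_measurable => [|i _]; first exact: finite_fset.
  exact: measurable_funPTI.
apply: eq_integral => w _; congr EFin; rewrite indicE.
case: (pselect (forall i, (i < n)%N -> B i (X i w))) => [BX|nBX].
  rewrite mem_set => [|i /=]; last by rewrite mem_J => /BX.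
  by rewrite big1// => i _; rewrite indicE mem_set//; exact: BX.
rewrite memNset => [|BX]; last by apply: nBX => i ni; apply: BX; rewrite /= mem_J.
move/existsNP : nBX => [i /not_implyP[ni nB]].
by rewrite (bigD1 (Ordinal ni))//= indicE memNset// mul0r.
Qed.

Lemma integral_prod_indep n (h : nat -> R -> R) :
    (forall i, measurable_fun setT (h i)) -> (forall i y, 0 <= h i y <= 1) ->
  (\int[P]_w (\prod_(i < n) h i (X i w))%:E =
   \prod_(i < n) \int[P]_w (h i (X i w))%:E)%E.
Proof.
move=> mh h01.
(* Induction on [m]: the factors of index at least [m] are indicators, and the others are freed one
   at a time. *)
suff: forall m, (m <= n)%N -> forall h : nat -> R -> R, (forall i, measurable_fun setT (h i)) ->
    (forall i y, 0 <= h i y <= 1) ->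
    (forall i, (m <= i)%N -> exists2 B, measurable B & h i = \1_B) ->
  (\int[P]_w (\prod_(i < n) h i (X i w))%:E =
   \prod_(i < n) \int[P]_w (h i (X i w))%:E)%E.
  (* Factors of index at least [n] do not occur in the product, so they may be replaced by an
     indicator. *)
  move=> /(_ n (leqnn n) (fun i => if (i < n)%N then h i else \1_set0)).
  under eq_integral do under eq_bigr do rewrite ltn_ord.
  under [in RHS]eq_bigr do under eq_integral do rewrite ltn_ord.
  apply.
  - by move=> i; case: ifP => // _; exact: measurable_indic.
  - by move=> i y; case: ifP => // _; rewrite indicE in_set0 lexx ler01.
  - by move=> i ni; exists set0 => //; rewrite ltnNge ni.
elim=> [_|m IH mn] {mh h01}{}h mh h01 hB.
  have /choice[B BP] : forall i, exists B, measurable B /\ h i = \1_B.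
    by move=> i; have [//|B mB hE] := hB i; exists B.
  rewrite (eq_integral (fun w => (\prod_(i < n) \1_(B i) (X i w))%:E)); last first.
    by move=> w _; congr EFin; apply: eq_bigr => i _; rewrite (BP i).2.
  rewrite integral_prod_indic => [|i]; last exact: (BP i).1.
  by apply: eq_bigr => i _; rewrite (BP i).2.
pose j := Ordinal mn.
have fin i : (\int[P]_w (h i (X i w))%:E)%E \is a fin_num.
  by apply: integral_fin_num01 => [|w]; [exact: measurableT_comp|exact: h01].
rewrite (bigD1 j)//= muleC.
pose Z w := \prod_(i < n | i != j) h i (X i w).
transitivity (\int[P]_w (Z w * h m (X m w))%:E)%E.
  by apply: eq_integral => w _; rewrite (bigD1 j)//= mulrC.
pose c := \prod_(i < n | i != j) fine (\int[P]_w (h i (X i w))%:E)%E.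
have cE : (c%:E = \prod_(i < n | i != j) \int[P]_w (h i (X i w))%:E)%E.
  by rewrite /c -prodEFin; apply: eq_bigr => i _; rewrite fineK.
rewrite (@ge0_integral_mul_indic_ext _ _ c)//.
- by rewrite cE.
- rewrite /Z; under eq_fun do rewrite -big_filter.
  by apply: measurable_prod => i _; exact: measurableT_comp.
- by move=> w; apply: prodr_ge0 => i _; have /andP[] := h01 i (X i w).
- apply: prodr_ge0 => i _; apply: fine_ge0; apply: integral_ge0 => w _.
  by rewrite lee_fin; have /andP[] := h01 i (X i w).
(* With factor [m] replaced by [\1_B] the induction hypothesis applies: [Z] and the events of [X m]
   factorize, with constant [c]. *)
- move=> B mB.
  have := IH (ltnW mn) (fun i => if i == m then \1_B else h i).
  rewrite (bigD1 j)//= eqxx => IHm.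
  transitivity (\int[P]_w (\prod_(i < n) (if i == m :> nat then \1_B else h i) (X i w))%:E)%E.
    apply: eq_integral => w _; rewrite (bigD1 j)//= eqxx mulrC; congr ((_ * _)%:E).
    by apply: eq_bigr => i; rewrite -val_eqE/= => /negbTE ->.
  rewrite IHm.
  + rewrite muleC cE; congr (_ * _)%E.
      by apply: eq_bigr => i; rewrite -val_eqE/= => /negbTE ->.
    rewrite -[X in P X]setIT -integral_indic//; exact: measurable_funPTI.
  + by move=> i; case: ifP => // _; exact: measurable_indic.
  + by move=> i y; case: ifP => // _; rewrite indicE; case: (_ \in _); rewrite ?lexx ler01.
  + move=> i mi; case: eqVneq => [_|im]; first by exists B.
    by apply: hB; rewrite ltn_neqAle eq_sym im.
- by move=> y; have /andP[] := h01 m y.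
Qed.
End independence.

(** * Pointwise bounds of the Laplace integrand along a grid *)

Section pointwise.
Context {R : realType}.
Implicit Types (s c y : R) (b x : nat -> R).

(* Num.max y 0 keeps it [0, 1]-valued also for negative y, where the X i may lie on a
   null set. *)
Definition trunc_exp s c y : R :=
  if y <= c then expR (- s * (Num.max y 0 / c)) else 0.

Lemma trunc_exp01 s c y : 0 <= s -> 0 <= c -> 0 <= trunc_exp s c y <= 1.
Proof.
move=> s0 c0; rewrite /trunc_exp; case: ifP => _; last by rewrite lexx ler01.
rewrite expR_ge0 -[leRHS]expR0 ler_expR mulNr oppr_le0 mulr_ge0//.
by rewrite divr_ge0// le_max lexx orbT.
Qed.

(* The factor carried by the j-th variable when the maximum is the i-th one and
   lies between b k and b k.+1. *)
Definition cell s b (i k : nat) c (j : nat) : R -> R :=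
  if j == i then \1_(`]b k, b k.+1] : set R) else trunc_exp s c.

Lemma cell01 s b i k c j y : 0 <= s -> 0 <= c -> 0 <= cell s b i k c j y <= 1.
Proof.
move=> s0 c0; rewrite /cell; case: ifP => _; last exact: trunc_exp01.
by rewrite indicE; case: (_ \in _); rewrite ?lexx ler01.
Qed.

(** At [x = fun i => X i w], this and [sum_max] are convertible to [partial_max] and
    [sum_max_ratio]. *)
Definition max_term x n := \big[Num.max/x 0%N]_(i < n) x i.

Definition sum_max x n : R :=
  if max_term x n == 0 then 1 else (\sum_(i < n) x i) / max_term x n.

Lemma max_term_ge x n (i : 'I_n) : x i <= max_term x n.
Proof. exact: le_bigmax. Qed.

Lemma max_termP x n : (0 < n)%N -> exists i : 'I_n, max_term x n = x i.
Proof.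
case: n => // n _; rewrite /max_term.
elim/big_ind: _ => [|_ _ [i ->] [j ->]|i _]; first by exists ord0.
  by case: (leP (x i) (x j)) => _; [exists j|exists i].
by exists i.
Qed.

Lemma sum_max_ge0 x n : (forall i, 0 <= x i) -> 0 <= sum_max x n.
Proof.
move=> x0; rewrite /sum_max; case: ifP => // _; rewrite divr_ge0 ?sumr_ge0//.
by rewrite /max_term; elim/big_ind: _ => // a b0 a0 _; rewrite le_max a0.
Qed.

(** The maximal term divided by itself gives 1, whence the factor [expR (- s)]. *)
Lemma expR_sum_max s x n (i : 'I_n) : 0 < x i -> max_term x n = x i ->
  expR (- s * sum_max x n) =
  expR (- s) * \prod_(j < n | j != i) expR (- s * (x j / x i)).
Proof.
move=> xi0 Mi; rewrite /sum_max Mi gt_eqF//.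
rewrite (bigD1 i)//= mulrDl divff ?gt_eqF// mulrDr mulr1 expRD.
by rewrite mulr_suml mulr_sumr expR_sum.
Qed.

Lemma nat_interval b y K : b 0%N < y -> y <= b K ->
  exists2 k, (k < K)%N & b k < y <= b k.+1.
Proof.
elim: K => [b0 /(lt_le_trans b0)|K IH b0 yK]; first by rewrite ltxx.
have [yK'|Ky] := leP y (b K).
  by have [k kK ky] := IH b0 yK'; exists k => //; exact: ltnW.
by exists K => //; rewrite Ky.
Qed.

(* The first two terms account for a maximum at most b 0 or above b K. *)
Lemma expR_sum_max_le s b x n K : 0 <= s -> 0 < b 0%N ->
    {homo b : m k / (m <= k)%N >-> m <= k} ->
    (forall i, 0 <= x i) -> (0 < n)%N ->
  expR (- s * sum_max x n) <=
    \prod_(i < n) \1_(`]-oo, b 0%N] : set R) (x i) +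
    (\sum_(i < n) \1_(`]b K, +oo[ : set R) (x i) +
     \sum_(i < n) \sum_(k < K) expR (- s) *
        \prod_(j < n) cell s b i k (b k.+1) j (x j)).
Proof.
move=> s0 b0 bh x0 n0.
have bp k : 0 < b k by apply: lt_le_trans b0 _; exact: bh.
have le1 : expR (- s * sum_max x n) <= 1.
  by rewrite -expR0 ler_expR mulNr oppr_le0 mulr_ge0// sum_max_ge0.
have c0 i k j : 0 <= cell s b i k (b k.+1) j (x j).
  by have /andP[] := @cell01 s b i k (b k.+1) j (x j) s0 (ltW (bp _)).
have t1 : (0 : R) <= \prod_(i < n) \1_(`]-oo, b 0%N] : set R) (x i).
  by apply: prodr_ge0 => i _; rewrite indicE ler0n.
have t2 : (0 : R) <= \sum_(i < n) \1_(`]b K, +oo[ : set R) (x i).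
  by apply: sumr_ge0 => i _; rewrite indicE ler0n.
have t3 : 0 <= \sum_(i < n) \sum_(k < K) expR (- s) *
        \prod_(j < n) cell s b i k (b k.+1) j (x j).
  apply: sumr_ge0 => i _; apply: sumr_ge0 => k _.
  by rewrite mulr_ge0 ?expR_ge0// prodr_ge0.
have [i Mi] := max_termP x n0.
have [xb0|xb0] := leP (x i) (b 0%N).
  apply: (le_trans le1); rewrite big1 ?lerDl ?addr_ge0// => j _.
  rewrite indicE mem_set//= in_itv/=; apply: le_trans xb0.
  by rewrite -Mi max_term_ge.
have [xK|xK] := leP (x i) (b K); last first.
  apply: (le_trans le1); apply: ler_wpDl => //; apply: ler_wpDr => //.
  rewrite (bigD1 i)//= indicE mem_set ?lerDl ?sumr_ge0//.
  by rewrite /= in_itv/= xK.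
have [k kK kx] := nat_interval xb0 xK.
(* Only the term of the maximal index [i] and of the cell [k] containing [x i] is kept; all the
   others are nonnegative. *)
rewrite -[leLHS]add0r lerD// -[leLHS]add0r lerD//.
rewrite (bigD1 i)//= (bigD1 (Ordinal kK))//=.
rewrite -addrA -[leLHS]addr0 lerD//; last first.
  rewrite addr_ge0// sumr_ge0// => *.
    by rewrite mulr_ge0 ?expR_ge0// prodr_ge0.
  by rewrite sumr_ge0// => *; rewrite mulr_ge0 ?expR_ge0// prodr_ge0.
have xi0 : 0 < x i by exact: lt_trans xb0.
rewrite (expR_sum_max _ xi0 Mi) ler_wpM2l ?expR_ge0//.
rewrite [leRHS](bigD1 i)//= {1}/cell eqxx indicE mem_set ?mul1r//.
apply: ler_prod => j ji; rewrite expR_ge0 /cell val_eqE (negbTE ji) /trunc_exp /=.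
(* Values up to [x i] pass the truncation at [b k.+1], and dividing by [b k.+1 >= x i] only
   increases the exponential. *)
have xj : x j <= x i by rewrite -Mi max_term_ge.
have /andP[_ xk] := kx.
rewrite (le_trans xj xk) ler_expR !mulNr lerN2 ler_wpM2l//.
rewrite max_l// ler_wpM2l// lef_pV2 ?posrE//.
Qed.

(** At most one pair [(i, k)] has a nonzero term, since such a term forces every other [x j] to be
    at most [b k < x i]. If the two largest values share a cell the sum is 0, which is harmless for
    a lower bound. *)
Lemma expR_sum_max_ge s b x n K : 0 <= s -> 0 < b 0%N ->
    {homo b : m k / (m <= k)%N >-> m <= k} ->
    (forall i, 0 <= x i) -> (0 < n)%N ->
  \sum_(i < n) \sum_(k < K) expR (- s) *
        \prod_(j < n) cell s b i k (b k) j (x j) <= expR (- s * sum_max x n).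
Proof.
move=> s0 b0 bh x0 n0.
have bp k : 0 < b k by apply: lt_le_trans b0 _; exact: bh.
pose t (i : 'I_n) (k : 'I_K) := \prod_(j < n) cell s b i k (b k) j (x j).
have tP i k : t i k != 0 ->
    b k < x i <= b k.+1 /\ forall j : 'I_n, j != i -> x j <= b k.
  move=> tn0; split.
    apply: contraNT tn0 => kx; rewrite /t (bigD1 i)//= /cell eqxx indicE.
    by rewrite memNset ?mul0r//= in_itv/= (negbTE kx).
  move=> j ji; rewrite leNgt; apply: contraNN tn0 => kx.
  rewrite /t (bigD1 j)//= /cell val_eqE (negbTE ji) /trunc_exp leNgt kx.
  by rewrite mul0r.
have [t0|] := pselect (forall i k, t i k = 0).
  rewrite big1 ?expR_ge0// => i _; rewrite big1// => k _.
  by rewrite -/(t i k) t0 mulr0.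
move=> /existsNP[i /existsNP[k /eqP tik]].
have [kx xj] := tP _ _ tik.
have uniq i' k' : t i' k' != 0 -> i' = i /\ k' = k.
  move=> /tP[/andP[kx' xk'] xj']; have /andP[kx1 xk1] := kx.
  have ii : i' = i.
    (* Otherwise [x i <= b k' < x i' <= b k], against [b k < x i]. *)
    apply: contraTeq kx1 => i'i; rewrite -leNgt (le_trans (xj' i _)) 1?eq_sym//.
    by rewrite ltW// (lt_le_trans kx')// xj.
  split => //; rewrite ii in kx' xk'; apply/val_inj/le_anti => /=.
  rewrite !leEnat; apply/andP; split; rewrite leqNgt; apply/negP => kk.
    by have := lt_le_trans kx' xk1; rewrite ltNge bh.
  by have := lt_le_trans kx1 xk'; rewrite ltNge bh.
rewrite (bigD1 i)//= [X in _ + X]big1 ?addr0; last first.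
  move=> i' i'i; apply: big1 => k' _; rewrite -/(t i' k').
  have [->|/uniq[ii _]] := eqVneq (t i' k') 0; first by rewrite mulr0.
  by rewrite ii eqxx in i'i.
rewrite (bigD1 k)//= [X in _ + X]big1 ?addr0; last first.
  move=> k' k'k; rewrite -/(t i k').
  have [->|/uniq[_ kk]] := eqVneq (t i k') 0; first by rewrite mulr0.
  by rewrite kk eqxx in k'k.
have /andP[bx xb] := kx.
have xi0 : 0 < x i by exact: lt_trans bx.
have Mi : max_term x n = x i.
  apply/le_anti; rewrite max_term_ge andbT.
  have [j ->] := max_termP x n0.
  by have [->//|/xj /le_trans->//] := eqVneq j i; exact: ltW.
rewrite (expR_sum_max _ xi0 Mi) ler_wpM2l ?expR_ge0//.
rewrite (bigD1 i)//= {1}/cell eqxx indicE mem_set ?mul1r//.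
apply: ler_prod => j ji; rewrite /cell val_eqE (negbTE ji).
have /andP[-> _]/= := trunc_exp01 (x j) s0 (ltW (bp k)).
rewrite /trunc_exp xj// ler_expR !mulNr lerN2 ler_wpM2l// max_l//.
by rewrite ler_wpM2l// lef_pV2 ?posrE// ltW.
Qed.
End pointwise.

(** * The level function, and integrals of powers near 0 *)

Section level_function.
Context {R : realType}.
Notation mu := (@lebesgue_measure R).

(* For 0 <= r < 1, the r-superlevel set of y |-> 1 - trunc_exp s c y is
   ]c * level s r, +oo[. *)
Definition level (s r : R) : R := Num.min 1 (- ln (1 - r) / s).

Lemma level_le1 s r : level s r <= 1.
Proof. by rewrite ge_min lexx. Qed.

(** From [r <= - ln (1 - r)]. This linear lower bound gives the integrability of powers of the level
    with exponent above -1. *)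
Lemma level_ge s r : 0 < s -> 0 <= r < 1 -> Num.min 1 s^-1 * r <= level s r.
Proof.
move=> s0 /andP[r0 r1]; rewrite /level le_min; apply/andP; split.
  rewrite -[leRHS]mulr1 ler_pM ?le_min ?ler01 ?invr_ge0 ?(ltW s0) ?(ltW r1)//.
  by rewrite ge_min lexx.
rewrite mulrC ler_pM ?le_min ?ler01 ?invr_ge0 ?(ltW s0)//.
  by rewrite lerNr le_ln1Dx// ltrN2.
by rewrite ge_min lexx orbT.
Qed.

Lemma level_gt0 s r : 0 < s -> 0 < r < 1 -> 0 < level s r.
Proof.
move=> s0 /andP[r0 r1]; apply: (@lt_le_trans _ _ (Num.min 1 s^-1 * r)).
  by rewrite mulr_gt0// lt_min ltr01 invr_gt0.
by apply: level_ge; rewrite ?(ltW r0).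
Qed.

Lemma level_ge0 s r : 0 < s -> 0 <= r < 1 -> 0 <= level s r.
Proof.
move=> s0 /andP[r0 r1]; apply: le_trans (level_ge s0 _); last by rewrite r0.
by rewrite mulr_ge0// le_min ler01 invr_ge0 ltW.
Qed.

(** For [r <= 1/2], [- ln (1 - r) <= r / (1 - r) <= 2 r] accounts for [2 / s]; for [r > 1/2], the
    level is at most [1 <= 2 r]. The bound serves to prove divergence when [alpha >= 1]. *)
Lemma level_le s r : 0 < s -> 0 < r < 1 -> level s r <= (2 / s + 2) * r.
Proof.
move=> s0 /andP[r0 r1].
have [r2|r2] := leP r 2^-1; last first.
  apply: (le_trans (level_le1 s r)); rewrite mulrDl -[leLHS]add0r lerD//.
    by rewrite !mulr_ge0 ?invr_ge0 ?ltW.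
  by rewrite -ler_pdivrMl// mulr1 ltW.
rewrite ge_min; apply/orP; right.
rewrite mulrDl -[leLHS]addr0 lerD ?mulr_ge0 ?(ltW r0)//.
rewrite mulrAC ler_wpM2r ?invr_ge0 ?(ltW s0)//.
have u0 : 0 < 1 - r by rewrite subr_gt0.
rewrite -lnV ?posrE//.
have -> : (1 - r)^-1 = 1 + r / (1 - r) by field; rewrite gt_eqF.
apply: (@le_trans _ _ (r / (1 - r))).
  by apply: le_ln1Dx; apply: (@lt_trans _ _ 0); rewrite ?ltrN10// divr_gt0.
rewrite mulrC ler_wpM2r ?(ltW r0)// invf_ple ?posrE//.
by rewrite lerBrDl -lerBrDr; apply: (le_trans r2); lra.
Qed.

Lemma measurable_level s : measurable_fun [set: R] (level s).
Proof.
apply: measurable_minr => //; apply: measurable_funM => //.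
apply: measurableT_comp => //; apply: (measurableT_comp (@measurable_ln R)).
exact: measurable_funB.
Qed.

Lemma integral_is_derive (f F : R -> R) (a b : R) : a < b ->
    (forall x, a <= x <= b -> is_derive x 1 F (f x)) ->
    (forall x, a <= x <= b -> derivable f x 1) ->
  (\int[mu]_(x in `[a, b]) (f x)%:E = (F b - F a)%:E)%E.
Proof.
move=> ab dF df.
have cont (g : R -> R) x : derivable g x 1 -> {for x, continuous g}.
  by move=> dg; apply: differentiable_continuous; exact/derivable1_diffP.
have cF x : a <= x <= b -> {for x, continuous F}.
  by move=> /dF dFx; apply: cont; exact: ex_derive.
rewrite (@continuous_FTC2 _ f F a b)//.
- apply: continuous_in_subspaceT => x; rewrite inE/= in_itv/= => xab.
  exact: cont (df _ xab).
- split.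
  + by move=> x; rewrite in_itv/= => /andP[ax xb]; apply/ex_derive/dF; rewrite !ltW.
  + by apply/cvg_at_right_filter/cF; rewrite lexx ltW.
  + by apply/cvg_at_left_filter/cF; rewrite lexx ltW.
- move=> x; rewrite in_itv/= => /andP[ax xb]; rewrite derive1E.
  by have [|_ ->] := dF x; rewrite ?ltW.
Qed.

Lemma integral_powR_seg (e p : R) : 0 < e -> e < 1 -> p != 1 ->
  (\int[mu]_(r in `[e, 1%R]) (r `^ (- p))%:E = ((1 - e `^ (1 - p)) / (1 - p))%:E)%E.
Proof.
move=> e0 e1 p1.
have p0 : 1 - p != 0 by rewrite subr_eq0 eq_sym.
pose F r := (1 - p)^-1 * r `^ (1 - p).
have dF x : e <= x <= 1 -> is_derive x 1 F (x `^ (- p)).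
  move=> /andP[ex x1]; have x0 := lt_le_trans e0 ex.
  have := is_deriveZ (1 - p)^-1 (is_derive1_powR (1 - p) x0).
  by rewrite /GRing.scale/= mulKf// addrAC subrr add0r.
have df x : e <= x <= 1 -> derivable (fun r => r `^ (- p)) x 1.
  move=> /andP[ex x1]; apply: derivable_powR.
  by rewrite in_itv/= andbT (lt_le_trans e0 ex).
have -> := integral_is_derive e1 dF df.
by rewrite /F powR1 -mulrBr mulrC.
Qed.

Lemma integral_inv_seg (e : R) : 0 < e -> e < 1 ->
  (\int[mu]_(r in `[e, 1%R]) (r ^-1)%:E = (- ln e)%:E)%E.
Proof.
move=> e0 e1.
have dF x : e <= x <= 1 -> is_derive x 1 (@ln R) x^-1.
  by move=> /andP[ex x1]; apply: is_derive1_ln; exact: lt_le_trans ex.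
have df x : e <= x <= 1 -> derivable (fun r : R => r^-1) x 1.
  move=> /andP[ex x1]; apply: derivableV => //.
  by rewrite gt_eqF//; exact: lt_le_trans ex.
have -> := integral_is_derive e1 dF df.
by rewrite ln1 sub0r.
Qed.

Let seg01 : \bigcup_n `[n.+2%:R^-1, 1%R]%classic = `]0, 1%R]%classic :> set R.
Proof.
apply/seteqP; split => [x [n _] /=|x /=]; rewrite !in_itv/= => /andP[nx x1].
  by rewrite x1 andbT (lt_le_trans _ nx)// invr_gt0.
exists (Num.truncn x^-1) => //=; rewrite in_itv/= x1 andbT.
rewrite invf_ple ?posrE//.
rewrite ltW// (lt_le_trans (truncnS_gt _))// ler_nat//.
Qed.

Let seg_cvg (f : R -> R) : measurable_fun [set: R] f -> (forall x, 0 < x -> 0 <= f x) ->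
  (\int[mu]_(r in `[n.+2%:R^-1%R, 1%R]) (f r)%:E @[n --> \oo] -->
   \int[mu]_(r in `]0%R, 1%R[) (f r)%:E)%E.
Proof.
move=> mf f0; rewrite (@integral_itv_bndo_bndc _ (BRight 0) 1).
  rewrite -seg01; apply: ge0_nondecreasing_set_cvg_integral => //.
  - move=> m n mn; apply/subsetPset => x /=; rewrite !in_itv/= => /andP[mx ->].
    by rewrite andbT (le_trans _ mx)// lef_pV2 ?posrE// ler_nat.
  - by move=> i; apply/measurable_EFinP; exact: measurable_funS mf.
  - move=> i x /=; rewrite in_itv/= => /andP[ix _]; rewrite lee_fin f0//.
    by rewrite (lt_le_trans _ ix)// invr_gt0.
by apply/measurable_EFinP; exact: measurable_funS mf.
Qed.

Let inv_lt1 n : (n.+2%:R : R)^-1 < 1.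
Proof. by rewrite invf_lt1// ltr1n. Qed.

Lemma integral_powR_lty (p : R) : p < 1 ->
  (\int[mu]_(r in `]0%R, 1%R[) (r `^ (- p))%:E < +oo)%E.
Proof.
move=> p1; have := seg_cvg (measurable_powR (- p)) (fun x _ => powR_ge0 _ _).
move=> cv; apply: (@le_lt_trans _ _ ((1 - p)^-1)%:E); last by rewrite ltry.
rewrite -(cvg_lim _ cv)//; apply: lime_le; first by apply/cvg_ex; eexists; exact: cv.
apply: nearW => n; rewrite integral_powR_seg ?lt_eqF//.
rewrite lee_fin ler_pdivrMr ?subr_gt0// mulVf ?gt_eqF ?subr_gt0//.
Qed.

Lemma integral_powRN1_y : (\int[mu]_(r in `]0%R, 1%R[) (r `^ (-1))%:E = +oo)%E.
Proof.
have mV : measurable_fun [set: R] (fun r : R => r `^ (-1)) by exact: measurable_powR.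
(* The integral of the inverse over [[e, 1]] is [- ln e], which is [A] for this [e]. *)
apply/eqyP => A A0; set e := expR (- A).
have e1 : e < 1 by rewrite -[ltRHS]expR0 ltr_expR oppr_lt0.
rewrite (@integral_itv_bndo_bndc _ (BRight 0) 1); last first.
  by apply/measurable_EFinP; exact: measurable_funS mV.
apply: (@le_trans _ _ (\int[mu]_(r in `[e, 1%R]) (r `^ (-1))%:E)%E).
  have -> : (\int[mu]_(r in `[e, 1%R]) (r `^ (-1))%:E =
      \int[mu]_(r in `[e, 1%R]) (r^-1)%:E)%E.
    apply: eq_integral => r; rewrite inE/= in_itv/= => /andP[er _].
    by rewrite powR_inv1// (le_trans _ er)// expR_ge0.
  by rewrite integral_inv_seg ?expR_gt0// expRK opprK.
apply: ge0_subset_integral => //.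
- by apply/measurable_EFinP; exact: measurable_funS mV.
- by move=> x _; rewrite lee_fin powR_ge0.
- move=> x /=; rewrite !in_itv/= => /andP[ex ->]; rewrite andbT.
  by rewrite (lt_le_trans _ ex)// expR_gt0.
Qed.

End level_function.

(** * Layer-cake formula for the truncated exponential *)

Section tail_formula.
Context {R : realType}.
Notation mu := (@lebesgue_measure R).

Lemma measurable_trunc_exp (s c : R) : measurable_fun [set: R] (trunc_exp s c).
Proof.
apply: measurable_fun_ifT => //.
- exact: measurable_fun_ler.
- apply: (measurableT_comp (@measurable_expR R)); apply: measurable_funM => //.
  apply: measurable_funM => //; exact: measurable_maxr.
Qed.

(** Beyond [c] both sides hold, as [level s r <= 1]; up to [c], take logarithms. Strictness on both
    sides yields the tail [1 - F] exactly, atoms included. *)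
Lemma lt_1_trunc_exp (s c y r : R) : 0 < s -> 0 < c -> 0 <= r < 1 ->
  (r < 1 - trunc_exp s c y) = (c * level s r < y).
Proof.
move=> s0 c0 /andP[r0 r1]; have r1' : 0 < 1 - r by rewrite subr_gt0.
rewrite /trunc_exp; have [yc|cy] := leP y c; last first.
  rewrite subr0 r1; apply/esym; apply: le_lt_trans cy.
  by rewrite ger_pMr// level_le1.
rewrite ltrBrDl addrC -ltrBrDl.
rewrite -[X in _ < X](@lnK _ (1 - r)) ?posrE// ltr_expR.
set L := ln (1 - r).
have L0 : 0 <= - L by rewrite oppr_ge0 ln_le0// gerBl.
have cL : 0 <= c * (- L / s) by rewrite mulr_ge0 ?divr_ge0 ?(ltW c0) ?(ltW s0).
transitivity (c * (- L / s) < Num.max y 0).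
  rewrite mulNr ltrNl mulrA ltr_pdivlMr// [s * _]mulrC mulrA.
  by rewrite ltr_pdivrMr// [c * _]mulrC.
(* The maximum with 0 is immaterial because [c * (- L / s)] is nonnegative, and the 1 in the minimum
   because [y <= c]. *)
rewrite lt_max [X in _ || X]ltNge cL orbF /level.
rewrite minr_pMr ?(ltW c0)// mulr1 gt_min.
by rewrite [X in X || _]ltNge yc.
Qed.

Lemma expectation_trunc_exp d (T : measurableType d) (P : probability T R)
    (X : {RV P >-> R}) (F : R -> R) (s c : R) : 0 < s -> 0 < c -> has_cdf X F ->
  (\int[P]_w (1 - trunc_exp s c (X w))%:E =
   \int[mu]_(r in `]0%R, 1%R[) (1 - F (c * level s r))%:E)%E.
Proof.
move=> s0 c0 XF.
have mY : measurable_fun [set: T] (fun w => 1 - trunc_exp s c (X w)).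
  apply: measurable_funB => //; apply: (measurableT_comp (measurable_trunc_exp _ _)).
  exact: measurable_funPT.
pose Y : {RV P >-> R} := mfun_Sub (mem_set mY).
have YE w : Y w = 1 - trunc_exp s c (X w) by [].
have Y0 w : 0 <= Y w.
  by rewrite YE subr_ge0; have /andP[] := trunc_exp01 (X w) (ltW s0) (ltW c0).
have Fh : {homo F : x y / x <= y}.
  by move=> x y xy; rewrite -lee_fin -!XF cdf_nondecreasing.
have := ge0_expectation_ccdf Y0; rewrite expectation_def => ->.
transitivity (\int[mu]_(r in `[0%R, 1%R[) (1 - F (c * level s r))%:E)%E.
  rewrite [LHS]integral_mkcond [RHS]integral_mkcond; apply: eq_integral => r _.
  rewrite !patchE; have [r0|r0] := leP 0 r; last first.
    by rewrite !memNset//= in_itv/= leNgt r0.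
  rewrite mem_set/= ?in_itv/= ?r0//.
  have [r1|r1] := ltP r 1.
    rewrite mem_set/= ?in_itv/= ?r0 ?r1//.
    rewrite EFinB -XF -ccdf_1_cdf /ccdf /distribution /pushforward; congr (P _).
    apply/seteqP; split => w /=; rewrite !in_itv/= !andbT -lt_1_trunc_exp ?r0//.
  (* Levels [r >= 1] contribute nothing: [Y] is at most 1. *)
  rewrite memNset/= ?in_itv/= ?r0 ?ltNge ?r1//.
  rewrite /ccdf /distribution /pushforward (_ : _ @^-1` _ = set0) ?measure0//.
  apply/seteqP; split => w //=; rewrite in_itv/= andbT => rY.
  have : Y w <= 1.
    by rewrite YE gerBl; have /andP[] := trunc_exp01 (X w) (ltW s0) (ltW c0).
  by move=> /(lt_le_trans rY); rewrite ltNge r1.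
rewrite -(@integral_itv_obnd_cbnd _ 0)//.
apply/measurable_EFinP; apply: (@measurable_funS _ _ _ _ setT) => //.
apply: measurable_funB => //.
apply: (measurableT_comp (nondecreasing_measurable measurableT Fh)).
by apply: measurable_funM => //; exact: measurable_level.
Qed.
End tail_formula.

(** * Regular variation: Potter bound and limit of the tail integrals *)

Section tail_asymptotics.
Context {R : realType}.
Notation mu := (@lebesgue_measure R).
Notation D := (`]0%R, 1%R[%classic : set R).
Variables (alpha : R) (G : R -> R).
Hypothesis alpha_ge0 : 0 <= alpha.
Hypothesis G_anti : {homo G : x y / x <= y >-> y <= x}.
Hypothesis G_gt0 : forall x, 0 < x -> 0 < G x.
Hypothesis G_le1 : forall x, G x <= 1.
Hypothesis G_rv : forall t, 0 < t -> G (t * x) / G x @[x --> +oo] --> t `^ (- alpha).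

(** As [beta > alpha], beyond some [x0] doubling the argument divides [G] by at most 2 to the power
    [beta]. Iterated doublings compare [G y] with [G x] for [x0 <= y <= x]; below [x0], [G <= 1]
    suffices. *)
Lemma potter_bound (beta : R) : alpha < beta ->
  exists C x0 : R, [/\ 0 < C, 0 < x0 & forall x u, x0 <= x -> 0 < u <= 1 ->
    G (u * x) <= C * u `^ (- beta) * G x].
Proof.
move=> ab.
have beta0 : 0 < beta by exact: le_lt_trans ab.
have lt2 : (2 : R) `^ (- beta) < 2 `^ (- alpha).
  rewrite /powR !gt_eqF// ltr_expR ltr_pM2r ?ltrN2//.
  by rewrite ln_gt0// ltr1n.
pose B : R := 2 `^ beta.
have B0 : 0 < B by rewrite powR_gt0.
have B1 : 1 <= B by rewrite -(powRr0 2) ler_powR ?ler1n// ltW.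
have [x0 x00 dbl] : exists2 x0 : R, 0 < x0 &
    forall x, x0 <= x -> G x <= B * G (2 * x).
  have /cvgr_gt /(_ _ lt2) [M [_ PM]] := G_rv (ltr0n R 2).
  exists (Num.max M 0 + 1).
    by rewrite ltr_wpDl// le_max lexx orbT.
  move=> x Mx; have Mx' : Num.max M 0 < x.
    by apply: lt_le_trans Mx; rewrite ltrDl.
  move: Mx'; rewrite gt_max => /andP[/PM /= + x0'].
  rewrite ltr_pdivlMr ?G_gt0// powRN mulrC ltr_pdivrMr// => /ltW.
  by rewrite mulrC.
(* [j] bounds the number of doublings from [y] to [x]. The constant does not accumulate: the [B]
   gained by a doubling turns [x / (2 * y)] into [x / y] inside the power. *)
have step j : forall x y, x0 <= y -> y <= x -> x <= 2 ^+ j * y ->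
    G y <= B * (x / y) `^ beta * G x.
  have base x y : x0 <= y -> y <= x -> G x <= (x / y) `^ beta * G x.
    move=> x0y yx; have y0 := lt_le_trans x00 x0y.
    rewrite ler_peMl ?(ltW (G_gt0 _))// ?(lt_le_trans y0)//.
    rewrite -(powRr0 (x / y)) ler_powR ?(ltW beta0)//.
    by rewrite ler_pdivlMr// mul1r.
  elim: j => [|j IH] x y x0y yx.
    rewrite mul1r => xy.
    have -> : y = x by apply/le_anti; rewrite yx.
    rewrite -mulrA; apply: (le_trans (base x x _ _)) => //.
      exact: le_trans x0y yx.
    rewrite ler_peMl// mulr_ge0 ?powR_ge0// ltW// G_gt0//.
    by rewrite (lt_le_trans x00)// (le_trans x0y).
  have y0 := lt_le_trans x00 x0y.
  rewrite exprSr -mulrA => xy.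
  have [x2y|x2y] := leP x (2 * y).
    apply: (le_trans (dbl _ x0y)); rewrite -mulrA ler_wpM2l ?(ltW B0)//.
    by apply: le_trans (base x y x0y yx); exact: G_anti.
  have x02y : x0 <= 2 * y.
    by apply: (le_trans x0y); rewrite ler_peMl ?(ltW y0)// ler1n.
  apply: (le_trans (dbl _ x0y)); rewrite -mulrA ler_wpM2l ?(ltW B0)//.
  apply: (le_trans (IH x (2 * y) x02y (ltW x2y) xy)).
  rewrite le_eqVlt; apply/orP; left; apply/eqP; congr (_ * _).
  rewrite /B -powRM ?ler0n ?divr_ge0 ?mulr_ge0 ?(ltW y0) ?(le_trans (ltW y0) yx)//.
  by congr (_ `^ _); field; rewrite gt_eqF.
have Gx0 := G_gt0 x00.
(* Dividing by [G x0 <= 1] pays for the arguments [u * x < x0], where [G] is only bounded by 1. *)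
exists (B / G x0), x0; split => //; first by rewrite divr_gt0.
move=> x u x0x /andP[u0 u1].
have xp : 0 < x by exact: lt_le_trans x0x.
have step' y : x0 <= y -> y <= x -> G y <= B * (x / y) `^ beta * G x.
  move=> x0y yx; have y0 := lt_le_trans x00 x0y.
  apply: (step (Num.truncn (x / y)).+1) => //.
  rewrite -ler_pdivrMr// ltW// (lt_le_trans (truncnS_gt _))//.
  by rewrite -natrX ler_nat ltnW// ltn_expl.
have -> : u `^ (- beta) = (u^-1) `^ beta.
  by rewrite -powR_inv1 ?(ltW u0)// -powRrM mulN1r.
have [x0u|ux0] := leP x0 (u * x).
  apply: (le_trans (step' _ x0u _)); first by rewrite ger_pMl.
  have -> : x / (u * x) = u^-1 by field; rewrite !gt_eqF.
  rewrite ler_wpM2r ?(ltW (G_gt0 _))// ler_wpM2r ?powR_ge0//.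
  by rewrite ler_peMr ?(ltW B0)// invf_ge1// G_le1.
apply: (le_trans (G_le1 _)).
rewrite -[leRHS]mulrA mulrAC ler_pdivlMr// mul1r mulrA.
apply: (le_trans (step' _ (lexx _) x0x)).
rewrite ler_wpM2r ?(ltW (G_gt0 _))// ler_wpM2l ?(ltW B0)//.
apply: ge0_ler_powR; rewrite ?nnegrE ?invr_ge0 ?divr_ge0 ?(ltW beta0) ?(ltW xp) ?(ltW x00) ?(ltW u0)//.
by rewrite ler_pdivrMr// ler_pdivlMl// ltW.
Qed.

(** This is [H(alpha)], an extended real because it is infinite for [alpha >= 1]. *)
Definition limit_denominator (s : R) : \bar R :=
  (\int[mu]_(r in `]0%R, 1%R[) (level s r `^ (- alpha))%:E)%E.

Lemma measurable_level_powR s p : measurable_fun [set: R] (fun r => level s r `^ p).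
Proof. by apply: (measurableT_comp (measurable_powR p)); exact: measurable_level. Qed.

Lemma integral_level_powR_lty s p : 0 < s -> 0 <= p -> p < 1 ->
  (\int[mu]_(r in D) (level s r `^ (- p))%:E < +oo)%E.
Proof.
move=> s0 p0 p1; set c := Num.min 1 s^-1.
have c0 : 0 < c by rewrite lt_min ltr01 invr_gt0.
apply: (@le_lt_trans _ _ (\int[mu]_(r in D) (c `^ (- p) * r `^ (- p))%:E)%E); last first.
  under eq_integral do rewrite EFinM.
  rewrite ge0_integralZl_EFin ?powR_ge0//.
  - by rewrite lte_mul_pinfty ?lee_fin ?powR_ge0// integral_powR_lty.
  - by move=> r _; rewrite lee_fin powR_ge0.
  - by apply/measurable_EFinP; apply: measurable_funTS; exact: measurable_powR.
apply: ge0_le_integral => //.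
- by move=> r _; rewrite lee_fin powR_ge0.
- by apply/measurable_EFinP; apply: measurable_funTS; exact: measurable_level_powR.
- apply/measurable_EFinP; apply: measurable_funM => //.
  by apply: measurable_funTS; exact: measurable_powR.
- move=> r /=; rewrite in_itv/= => r01; have /andP[r0 r1] := r01.
  rewrite lee_fin -powRM ?(ltW r0) ?(ltW c0)// !powRN.
  rewrite lef_pV2 ?posrE ?powR_gt0 ?mulr_gt0 ?level_gt0//.
  apply: ge0_ler_powR; rewrite ?nnegrE ?mulr_ge0 ?(ltW r0) ?(ltW c0) ?level_ge0 ?(ltW r0)//.
  by rewrite level_ge ?(ltW r0).
Qed.

(** As [0 < level s r <= 1], the integrand is at least the inverse of the level, which [level_le]
    bounds below by a multiple of [1 / r]. *)
Lemma limit_denominator_y s : 0 < s -> 1 <= alpha -> limit_denominator s = +oo%E.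
Proof.
move=> s0 a1; set K := 2 / s + 2.
have K0 : 0 < K by rewrite addr_gt0// divr_gt0.
apply/eqP; rewrite -leye_eq.
have -> : (+oo = \int[mu]_(r in `]0%R, 1%R[) (K^-1 * r `^ (-1))%:E)%E.
  under eq_integral do rewrite EFinM.
  rewrite ge0_integralZl_EFin ?invr_ge0 ?(ltW K0)//.
  - by rewrite integral_powRN1_y gt0_muley// lte_fin invr_gt0.
  - by move=> r _; rewrite lee_fin powR_ge0.
  - by apply/measurable_EFinP; apply: measurable_funTS; exact: measurable_powR.
apply: ge0_le_integral => //.
- by move=> r _; rewrite lee_fin mulr_ge0 ?invr_ge0 ?(ltW K0) ?powR_ge0.
- apply/measurable_EFinP; apply: measurable_funM => //.
  by apply: measurable_funTS; exact: measurable_powR.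
- by apply/measurable_EFinP; apply: measurable_funTS; exact: measurable_level_powR.
- move=> r /=; rewrite in_itv/= => r01; have /andP[r0 r1] := r01.
  have l0 := level_gt0 s0 r01.
  rewrite lee_fin powR_inv1 ?(ltW r0)// -invfM.
  apply: (@le_trans _ _ (level s r)^-1).
    by rewrite lef_pV2 ?posrE ?mulr_gt0// level_le.
  rewrite -powR_inv1 ?(ltW l0)//; apply: ger_powR; rewrite ?lerN2//.
  by rewrite l0 level_le1.
Qed.

Lemma cvg_tail_integral s (b : nat -> R) : 0 < s ->
  (forall k, 0 < b k) -> b k @[k --> \oo] --> +oo ->
  ((\int[mu]_(r in `]0%R, 1%R[) (G (b k * level s r) / G (b k))%:E)%E
     @[k --> \oo] --> limit_denominator s).
Proof.
move=> s0 b0 boo.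
pose f k r := (G (b k * level s r) / G (b k))%:E.
have mf k : measurable_fun D (f k).
  apply/measurable_EFinP; apply: measurable_funTS; apply: measurable_funM => //.
  apply: (measurableT_comp (nonincreasing_measurable measurableT G_anti)).
  by apply: measurable_funM => //; exact: measurable_level.
have f0 k r : D r -> (0 <= f k r)%E.
  rewrite /= in_itv/= => r01; rewrite lee_fin divr_ge0 ?ltW ?G_gt0//.
  by rewrite mulr_gt0// level_gt0.
have cf r : D r -> f k r @[k --> \oo] --> (level s r `^ (- alpha))%:E.
  rewrite /= in_itv/= => r01; apply: cvg_EFin; first by apply: nearW => k.
  have /(_ _ boo) := (cvg_pinftyP _ _).1 (G_rv (level_gt0 s0 r01)).
  apply: cvg_trans; apply: near_eq_cvg; apply: nearW => k /=.
  by rewrite [b k * _]mulrC.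
have mL : measurable_fun D (fun r => (level s r `^ (- alpha))%:E).
  by apply/measurable_EFinP; apply: measurable_funTS; exact: measurable_level_powR.
have [a1|a1] := ltP alpha 1; last first.
  (* By Fatou the lower limit of the integrals is infinite, hence so is their limit. *)
  rewrite limit_denominator_y//.
  have := fatou mu (measurable_itv _ : measurable D) mf (fun k r => f0 k r).
  have -> : (\int[mu]_(r in D) limn_einf (f ^~ r) = limit_denominator s)%E.
    by apply: eq_integral => r /set_mem Dr; rewrite (cvg_limn_einf_sup (cf r Dr)).1.
  rewrite limit_denominator_y// leye_eq limn_einf_lim => /eqP inf_y.
  apply: (@gee_cvgy _ _ _ _ (einfs (fun k => \int[mu]_(r in D) f k r)%E)).
    apply: nearW => k; apply: ge_ereal_inf; exists (\int[mu]_(r in D) f k r)%E => //.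
    by exists k => //=.
  by rewrite -inf_y; exact: is_cvg_einfs.
(* For an exponent strictly between [alpha] and 1, the Potter bound gives an integrable dominating
   function. *)
pose beta := (alpha + 1) / 2.
have ab : alpha < beta by rewrite midf_lt.
have b1 : beta < 1 by rewrite midf_lt.
have beta0 : 0 <= beta by rewrite (le_trans alpha_ge0)// ltW.
have [C [x0 [C0 x00 GC]]] := potter_bound ab.
have [k0 _ bk0] : \forall k \near \oo, x0 <= b k by move/cvgryPge : boo; exact.
(* After a shift by [k0] the domination holds at every index. *)
rewrite -(cvg_shiftn k0).
pose g r := (C * level s r `^ (- beta))%:E.
have mg : measurable_fun D g.
  apply/measurable_EFinP; apply: measurable_funM => //.
  by apply: measurable_funTS; exact: measurable_level_powR.
have g0 r : (0 <= g r)%E by rewrite lee_fin mulr_ge0 ?powR_ge0// ltW.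
have [] // := @dominated_convergence _ _ _ mu D (measurable_itv _)
  (fun k => f (k + k0)%N) (fun r => (level s r `^ (- alpha))%:E) g.
- by move=> n; exact: mf.
- by apply: (aeW mu) => r Dr; rewrite (cvg_shiftn k0 (f ^~ r)); exact: cf.
- apply/integrableP; split => //.
  under eq_integral do rewrite gee0_abs//.
  under eq_integral do rewrite /g EFinM.
  rewrite ge0_integralZl_EFin ?(ltW C0)//.
  + by rewrite lte_mul_pinfty ?lee_fin ?(ltW C0)// integral_level_powR_lty.
  + by move=> r _; rewrite lee_fin powR_ge0.
  + by apply/measurable_EFinP; apply: measurable_funTS; exact: measurable_level_powR.
- apply: (aeW mu) => r k Dr; rewrite gee0_abs ?f0//.
  move: Dr; rewrite /= in_itv/= => r01; rewrite lee_fin.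
  rewrite ler_pdivrMr ?G_gt0// mulrC; apply: GC.
    by apply: bk0 => /=; rewrite leq_addl.
  by rewrite level_gt0// level_le1.
Qed.
End tail_asymptotics.

(** * Bounds of the Laplace transform along a grid *)

Section expectation_bounds.
Context {R : realType} d (T : measurableType d) (P : probability T R).
Notation mu := (@lebesgue_measure R).
Variables (X : nat -> {RV P >-> R}) (F : R -> R) (s : R).
Hypothesis s_gt0 : 0 < s.
Hypothesis X_iid : iid_with_cdf X F.

(* The expectation of trunc_exp s c (X i), written in terms of F only so that it
   visibly does not depend on i; see integral_trunc_exp. *)
Definition trunc_laplace (c : R) : R :=
  1 - fine (\int[mu]_(r in `]0%R, 1%R[) (1 - F (c * level s r))%:E)%E.

Let s_ge0 : 0 <= s. Proof. exact: ltW. Qed.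

Lemma cdf_homo : {homo F : x y / x <= y}.
Proof.
by move=> x y xy; rewrite -lee_fin -!(X_iid.2 0%N) cdf_nondecreasing.
Qed.

Lemma cdf01 x : 0 <= F x <= 1.
Proof. by rewrite -2!lee_fin -(X_iid.2 0%N) cdf_le1 cdf_ge0. Qed.

Lemma integral_trunc_exp i c : 0 < c ->
  (\int[P]_w (trunc_exp s c (X i w))%:E = (trunc_laplace c)%:E)%E.
Proof.
move=> c0; have XF := X_iid.2 i.
have mt : measurable_fun [set: T] (fun w => trunc_exp s c (X i w)).
  by apply: (measurableT_comp (measurable_trunc_exp _ _)); exact: measurable_funPT.
have t01 w : 0 <= trunc_exp s c (X i w) <= 1 := trunc_exp01 _ s_ge0 (ltW c0).
have m1t : measurable_fun [set: T] (fun w => 1 - trunc_exp s c (X i w)).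
  exact: measurable_funB.
have u01 w : 0 <= 1 - trunc_exp s c (X i w) <= 1.
  by have /andP[t0 t1] := t01 w; rewrite subr_ge0 t1 gerBl t0.
have ft := integral_fin_num01 P mt t01; have fu := integral_fin_num01 P m1t u01.
rewrite /trunc_laplace -(expectation_trunc_exp s_gt0 c0 XF) EFinB fineK//.
rewrite -[LHS](addeK _ fu)//; congr (_ - _)%E.
rewrite -ge0_integralD//.
- under eq_integral do rewrite -EFinD subrKC.
  by rewrite integral_cst// mul1e [LHS]probability_setT.
- by move=> w _; rewrite lee_fin; have /andP[] := t01 w.
- exact/measurable_EFinP.
- by move=> w _; rewrite lee_fin; have /andP[] := u01 w.
- exact/measurable_EFinP.
Qed.

Lemma integral_tail_level c : 0 < c ->
  (\int[mu]_(r in `]0%R, 1%R[) (1 - F (c * level s r))%:E =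
   (1 - trunc_laplace c)%:E)%E.
Proof.
move=> c0; rewrite /trunc_laplace subKr fineK//.
rewrite -(expectation_trunc_exp s_gt0 c0 (X_iid.2 0%N)).
apply: integral_fin_num01 => [|w].
  apply: measurable_funB => //; apply: (measurableT_comp (measurable_trunc_exp _ _)).
  exact: measurable_funPT.
have /andP[t0 t1] := trunc_exp01 (X 0%N w) s_ge0 (ltW c0).
by rewrite subr_ge0 t1 gerBl t0.
Qed.

Lemma trunc_laplace01 c : 0 < c -> 0 <= trunc_laplace c <= 1.
Proof.
move=> c0; have t01 w : 0 <= trunc_exp s c (X 0%N w) <= 1.
  exact: trunc_exp01 _ s_ge0 (ltW c0).
have mt : measurable_fun [set: T] (fun w => trunc_exp s c (X 0%N w)).
  by apply: (measurableT_comp (measurable_trunc_exp _ _)); exact: measurable_funPT.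
rewrite -!lee_fin -(integral_trunc_exp 0 c0); apply/andP; split.
  by apply: integral_ge0 => w _; rewrite lee_fin; have /andP[] := t01 w.
have <- : (\int[P]_w (cst 1%E w) = 1)%E.
  by rewrite integral_cst// mul1e [LHS]probability_setT.
apply: ge0_le_integral => //.
- by move=> w _; rewrite lee_fin; have /andP[] := t01 w.
- exact/measurable_EFinP.
- by move=> w _; rewrite lee_fin; have /andP[] := t01 w.
Qed.

Let mind i (A : set R) : measurable A -> measurable_fun [set: T] (fun w => \1_A (X i w) : R).
Proof.
by move=> mA; apply: (measurableT_comp (measurable_indic _)).
Qed.

Lemma integral_indic_preimage i (A : set R) : measurable A ->
  (\int[P]_w (\1_A (X i w))%:E = P (X i @^-1` A))%E.
Proof.
by move=> mA; rewrite -[X in P X]setIT -integral_indic//; exact: measurable_funPTI.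
Qed.

Lemma integral_indic_le i x : (\int[P]_w (\1_(`]-oo, x] : set R) (X i w))%:E = (F x)%:E)%E.
Proof. by rewrite integral_indic_preimage// -(X_iid.2 i). Qed.

Lemma integral_indic_gt i x :
  (\int[P]_w (\1_(`]x, +oo[ : set R) (X i w))%:E = (1 - F x)%:E)%E.
Proof.
rewrite integral_indic_preimage// EFinB -(X_iid.2 i).
by have := ccdf_1_cdf (X i) x.
Qed.

Lemma integral_indic_itv i x y : x <= y ->
  (\int[P]_w (\1_(`]x, y] : set R) (X i w))%:E = (F y - F x)%:E)%E.
Proof.
move=> xy; rewrite EFinB -(integral_indic_le i y) -(integral_indic_le i x).
have f z : (\int[P]_w (\1_(`]-oo, z] : set R) (X i w))%:E)%E \is a fin_num.
  by rewrite integral_indic_le.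
rewrite -[LHS](addeK _ (f x))//; congr (_ - _)%E.
rewrite -ge0_integralD//.
- apply: eq_integral => w _; rewrite -EFinD; congr EFin.
  rewrite !indicE !mem_setE !in_itv/= ltNge.
  have [Xx|_] /= := leP (X i w) x; last by rewrite addr0.
  by rewrite (le_trans Xx xy) add0r.
- by apply/measurable_EFinP; exact: mind.
- by apply/measurable_EFinP; exact: mind.
Qed.

(** By independence the term [(i, k)] yields one cell probability and [n.-1] equal factors, whatever
    [i], whence the factor [n]. The points [c k] are left free because the two bounds take them to
    be [b k] and [b k.+1]. *)
Lemma integral_cells n K (b c : nat -> R) : {homo b : m k / (m <= k)%N >-> m <= k} ->
    (forall k, 0 < c k) ->
  (\int[P]_w (\sum_(i < n) \sum_(k < K) expR (- s) *
        \prod_(j < n) cell s b i k (c k) j (X j w))%:E =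
   (n%:R * (expR (- s) * \sum_(k < K) (F (b k.+1) - F (b k)) * trunc_laplace (c k) ^+ n.-1))%:E)%E.
Proof.
move=> bh c0.
have mcell i k j : measurable_fun [set: R] (cell s b i k (c k) j).
  rewrite /cell; case: ifP => _; [exact: measurable_indic|exact: measurable_trunc_exp].
have cell01' i k j y := cell01 b i k j y s_ge0 (ltW (c0 k)).
have mprod i k : measurable_fun [set: T]
    (fun w => \prod_(j < n) cell s b i k (c k) j (X j w)).
  apply: measurable_prod => j _; apply: (measurableT_comp (mcell _ _ _)).
  exact: measurable_funPT.
have prod0 i k w : 0 <= \prod_(j < n) cell s b i k (c k) j (X j w).
  by apply: prodr_ge0 => j _; have /andP[] := cell01' i k j (X j w).
have e (i : 'I_n) k : (\int[P]_w (\prod_(j < n) cell s b i k (c k) j (X j w))%:E =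
    ((F (b k.+1) - F (b k)) * trunc_laplace (c k) ^+ n.-1)%:E)%E.
  rewrite (integral_prod_indep X_iid.1 n (mcell i k) (cell01' i k)).
  rewrite (bigD1 i)//= {1}/cell eqxx integral_indic_itv ?bh// EFinM; congr (_ * _)%E.
  rewrite (eq_bigr (fun=> (trunc_laplace (c k))%:E)) => [|j ji]; last first.
    by rewrite /cell val_eqE (negbTE ji) integral_trunc_exp.
  by rewrite prodEFin; congr EFin; rewrite prodr_const cardC1 card_ord.
have -> : (\int[P]_w (\sum_(i < n) \sum_(k < K) expR (- s) *
        \prod_(j < n) cell s b i k (c k) j (X j w))%:E =
   \sum_(i < n) \sum_(k < K) \int[P]_w ((expR (- s))%:E *
        (\prod_(j < n) cell s b i k (c k) j (X j w))%:E))%E.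
  under eq_integral do rewrite -sumEFin.
  rewrite ge0_integral_sum//.
  - apply: eq_bigr => i _; under eq_integral do rewrite -sumEFin.
    rewrite ge0_integral_sum//.
    + by move=> k; apply/measurable_EFinP; exact: measurable_funM.
    + by move=> k w _; rewrite lee_fin mulr_ge0 ?expR_ge0.
  - move=> i; apply/measurable_EFinP; apply: measurable_sum => k.
    exact: measurable_funM.
  - move=> i w _; rewrite lee_fin sumr_ge0// => k _.
    by rewrite mulr_ge0 ?expR_ge0.
rewrite (eq_bigr (fun=> (expR (- s) * \sum_(k < K) (F (b k.+1) - F (b k)) *
    trunc_laplace (c k) ^+ n.-1)%:E)); last first.
  move=> i _; rewrite mulr_sumr -sumEFin; apply: eq_bigr => k _.
  rewrite ge0_integralZl_EFin ?expR_ge0//; first by rewrite e -EFinM.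
  - by move=> w _; rewrite lee_fin.
  - exact/measurable_EFinP.
by rewrite sumEFin sumr_const card_ord mulr_natl.
Qed.

Hypothesis F_nonneg : nonneg_rv_cdf F.

Lemma nonneg_cdf_lt0 x : x < 0 -> F x = 0.
Proof.
case: F_nonneg => d' [T' [P' [Y [Y0 YF]]]] x0; apply: EFin_inj.
rewrite -(YF x) /cdf /distribution /pushforward (_ : _ @^-1` _ = set0) ?measure0//.
apply/seteqP; split => w //=; rewrite in_itv/= => /le_lt_trans /(_ x0).
by rewrite ltNge Y0.
Qed.

(** Only the distribution of [X i] is given, so nonnegativity is merely almost sure: [X i < 0] is
    the union of the null events [X i <= - 1 / (n + 1)]. *)
Lemma ae_ge0 : {ae P, forall w, forall i, 0 <= X i w}.
Proof.
apply: ae_foralln => i.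
have : P.-negligible (\bigcup_n (X i @^-1` `]-oo, - (n.+1%:R^-1)])).
  apply: negligible_bigcup => n; exists (X i @^-1` `]-oo, - (n.+1%:R^-1)]).
  split => //; first exact: measurable_funPTI.
  rewrite -[LHS]/(cdf (X i) (- n.+1%:R^-1)) (X_iid.2 i) nonneg_cdf_lt0 // oppr_lt0 invr_gt0.
apply: negligibleS => w /= /negP; rewrite -ltNge => Xw.
exists (Num.truncn (- X i w)^-1) => //=; rewrite in_itv/= lerNr.
rewrite invf_ple ?posrE ?oppr_gt0//.
by rewrite ltW// truncnS_gt.
Qed.

Lemma measurable_sum_max_ratio n : measurable_fun [set: T] (sum_max_ratio X n).
Proof.
have mX i : measurable_fun [set: T] (X i) by exact: measurable_funPT.
have mM : measurable_fun [set: T] (partial_max X n).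
  rewrite /partial_max; elim: (index_enum _) => [|i r IH].
    under eq_fun do rewrite big_nil; exact: mX.
  by under eq_fun do rewrite big_cons; exact: measurable_maxr.
have mS : measurable_fun [set: T] (partial_sum X n) by exact: measurable_sum.
apply: measurable_fun_ifT => //; first exact: measurable_fun_eqr.
(* The inverse of the maximum [M] becomes [M] times the power -1 of its square, built from
   measurable functions. The square makes the base nonnegative, and at [M = 0] both sides vanish. *)
have -> : (fun w => partial_sum X n w / partial_max X n w) =
    (fun w => partial_sum X n w * (partial_max X n w * (partial_max X n w ^+ 2) `^ (-1))).
  apply/funext => w; congr (_ * _); rewrite powR_inv1 ?sqr_ge0//.
  have [->|M0] := eqVneq (partial_max X n w) 0; first by rewrite mul0r invr0.
  by field.
apply: measurable_funM => //; apply: measurable_funM => //.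
by apply: (measurableT_comp (measurable_powR _)); exact: measurable_funX.
Qed.

Let measurable_laplace n : measurable_fun [set: T]
  (fun w => expR (- s * sum_max_ratio X n w)).
Proof.
apply: (measurableT_comp (@measurable_expR R)).
by apply: measurable_funM => //; exact: measurable_sum_max_ratio.
Qed.

(** Expectation of [expR_sum_max_le], which holds almost surely: the first term is the probability
    that no variable exceeds [b 0], the second a union bound for a maximum above [b K]. *)
Lemma laplace_le (b : nat -> R) n K : 0 < b 0%N ->
    {homo b : m k / (m <= k)%N >-> m <= k} -> (0 < n)%N ->
  (laplace P (sum_max_ratio X n) s <=
   (F (b 0%N) ^+ n + (n%:R * (1 - F (b K)) +
    n%:R * (expR (- s) * \sum_(k < K) (F (b k.+1) - F (b k)) *
      trunc_laplace (b k.+1) ^+ n.-1)))%:E)%E.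
Proof.
move=> b0 bh n0; rewrite /laplace expectation.unlock.
have bp k : 0 < b k by apply: lt_le_trans b0 _; exact: bh.
have mI (A : set R) : measurable A -> measurable_fun [set: R] (\1_A : R -> R).
  by move=> mA; exact: measurable_indic.
have I01 (A : set R) y : 0 <= (\1_A y : R) <= 1.
  by rewrite indicE; case: (_ \in _); rewrite ?lexx ler01.
pose h1 w : R := \prod_(i < n) \1_(`]-oo, b 0%N] : set R) (X i w).
pose h2 w : R := \sum_(i < n) \1_(`]b K, +oo[ : set R) (X i w).
pose h3 w : R := \sum_(i < n) \sum_(k < K) expR (- s) *
        \prod_(j < n) cell s b i k (b k.+1) j (X j w).
have mh1 : measurable_fun [set: T] h1.
  by apply: measurable_prod => i _; exact: mind.
have mh2 : measurable_fun [set: T] h2.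
  by apply: measurable_sum => i; exact: mind.
have mcell i k j : measurable_fun [set: R] (cell s b i k (b k.+1) j).
  rewrite /cell; case: ifP => _; [exact: measurable_indic|exact: measurable_trunc_exp].
have mh3 : measurable_fun [set: T] h3.
  apply: measurable_sum => i; apply: measurable_sum => k.
  apply: measurable_funM => //; apply: measurable_prod => j _.
  by apply: (measurableT_comp (mcell _ _ _)); exact: measurable_funPT.
have h10 w : 0 <= h1 w by apply: prodr_ge0 => i _; have /andP[] := I01 `]-oo, b 0%N]%classic (X i w).
have h20 w : 0 <= h2 w by apply: sumr_ge0 => i _; have /andP[] := I01 `]b K, +oo[%classic (X i w).
have h30 w : 0 <= h3 w.
  apply: sumr_ge0 => i _; apply: sumr_ge0 => k _; rewrite mulr_ge0 ?expR_ge0//.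
  apply: prodr_ge0 => j _.
  by have /andP[] := cell01 b i k j (X j w) s_ge0 (ltW (bp k.+1)).
have -> : ((F (b 0%N) ^+ n + (n%:R * (1 - F (b K)) +
    n%:R * (expR (- s) * \sum_(k < K) (F (b k.+1) - F (b k)) *
      trunc_laplace (b k.+1) ^+ n.-1)))%:E =
    \int[P]_w (h1 w + (h2 w + h3 w))%:E)%E.
  under eq_integral do rewrite EFinD.
  rewrite ge0_integralD//; last 4 first.
  - by move=> w _; rewrite lee_fin.
  - exact/measurable_EFinP.
  - by move=> w _; rewrite lee_fin addr_ge0.
  - by apply/measurable_EFinP; exact: measurable_funD.
  under [in X in _ = (_ + X)%E]eq_integral do rewrite EFinD.
  rewrite ge0_integralD//; last 4 first.
  - by move=> w _; rewrite lee_fin.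
  - exact/measurable_EFinP.
  - by move=> w _; rewrite lee_fin.
  - exact/measurable_EFinP.
  rewrite EFinD; congr (_ + _)%E; last rewrite EFinD; last congr (_ + _)%E.
  - rewrite (integral_prod_indep X_iid.1 n (fun=> mI _ (measurable_itv _)) (fun=> I01 _)).
    rewrite (eq_bigr (fun=> (F (b 0%N))%:E)) => [|i _]; last exact: integral_indic_le.
    by rewrite prodEFin prodr_const card_ord.
  - rewrite /h2; under eq_integral do rewrite -sumEFin.
    rewrite ge0_integral_sum//.
    + rewrite (eq_bigr (fun=> (1 - F (b K))%:E)) => [|i _]; last exact: integral_indic_gt.
      by rewrite sumEFin sumr_const card_ord mulr_natl.
    + by move=> i; apply/measurable_EFinP; exact: mind.
  - by rewrite /h3 (@integral_cells n K b (fun k => b k.+1)).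
apply: ae_ge0_le_integral => //.
- exact/measurable_EFinP.
- by move=> w _; rewrite lee_fin !addr_ge0.
- by apply/measurable_EFinP; apply: measurable_funD => //; exact: measurable_funD.
- have := ae_ge0; apply: filterS => w Xw _; rewrite lee_fin.
  exact: (@expR_sum_max_le _ s b (fun i => X i w)).
Qed.

Lemma laplace_ge (b : nat -> R) n K : 0 < b 0%N ->
    {homo b : m k / (m <= k)%N >-> m <= k} -> (0 < n)%N ->
  ((n%:R * (expR (- s) * \sum_(k < K) (F (b k.+1) - F (b k)) *
      trunc_laplace (b k) ^+ n.-1))%:E <= laplace P (sum_max_ratio X n) s)%E.
Proof.
move=> b0 bh n0; rewrite /laplace expectation.unlock.
have bp k : 0 < b k by apply: lt_le_trans b0 _; exact: bh.
have mcell i k j : measurable_fun [set: R] (cell s b i k (b k) j).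
  rewrite /cell; case: ifP => _; [exact: measurable_indic|exact: measurable_trunc_exp].
rewrite -integral_cells//.
apply: ae_ge0_le_integral => //.
- move=> w _; rewrite lee_fin.
  apply: sumr_ge0 => i _; apply: sumr_ge0 => k _; rewrite mulr_ge0 ?expR_ge0//.
  apply: prodr_ge0 => j _.
  by have /andP[] := cell01 b i k j (X j w) s_ge0 (ltW (bp k)).
- apply/measurable_EFinP; apply: measurable_sum => i; apply: measurable_sum => k.
  apply: measurable_funM => //; apply: measurable_prod => j _.
  by apply: (measurableT_comp (mcell _ _ _)); exact: measurable_funPT.
- exact/measurable_EFinP.
- have := ae_ge0; apply: filterS => w Xw _; rewrite lee_fin.
  exact: (@expR_sum_max_ge _ s b (fun i => X i w)).
Qed.

End expectation_bounds.

(** * Telescoping sums of powers *)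

Section telescoping.
Context {R : realType}.
Implicit Types (a b theta : R) (p q : nat -> R).

(** After factoring out [a - b], each of the [n] remaining monomials is at least [b ^+ n.-1]. *)
Lemma subrXX_ge a b n : 0 <= b -> b <= a ->
  n%:R * (a - b) * b ^+ n.-1 <= a ^+ n - b ^+ n.
Proof.
move=> b0 ba; rewrite subrXX mulrAC mulrC ler_wpM2l ?subr_ge0//.
rewrite mulr_natl -[X in _ *+ X](card_ord n) -sumr_const; apply: ler_sum => i _.
have ni : n.-1 = (n.-1 - i + i)%N by have := ltn_ord i; lia.
rewrite [in leLHS]ni exprD ler_wpM2r ?exprn_ge0// lerXn2r ?nnegrE//.
exact: le_trans ba.
Qed.

Lemma subrXX_le a b n : 0 <= b -> b <= a ->
  a ^+ n - b ^+ n <= n%:R * (a - b) * a ^+ n.-1.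
Proof.
move=> b0 ba; rewrite subrXX mulrAC [leRHS]mulrC ler_wpM2l ?subr_ge0//.
rewrite mulr_natl -[X in _ *+ X](card_ord n) -sumr_const; apply: ler_sum => i _.
have ni : n.-1 = (n.-1 - i + i)%N by have := ltn_ord i; lia.
rewrite [in leRHS]ni exprD ler_wpM2l ?exprn_ge0 ?(le_trans b0)//.
by rewrite lerXn2r ?nnegrE// (le_trans b0).
Qed.

(** Put [r k = 1 - theta * q k], nondecreasing in [k]. The shift between [p k.+1] and [q k] puts the
    power at the lower endpoint [r k], so [subrXX_ge] bounds [theta * n] times each summand by
    [r k.+1 ^+ n - r k ^+ n]; these telescope to at most 1. *)
Lemma telescope_pow_le p q theta n K : 0 < theta -> (0 < n)%N ->
    (forall k, 0 <= q k) -> (forall k, q k.+1 <= q k) ->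
    (forall k, 0 <= p k) -> (forall k, p k.+1 <= 1 - theta * q k) ->
  n%:R * (\sum_(k < K) (q k - q k.+1) * p k.+1 ^+ n.-1) <= theta^-1.
Proof.
move=> theta0 n0 q0 qd p0 pq.
have r0 k : 0 <= 1 - theta * q k by exact: le_trans (pq k).
rewrite -(mulr1 theta^-1) ler_pdivlMl//.
apply: (@le_trans _ _ (\sum_(k < K) ((1 - theta * q k.+1) ^+ n - (1 - theta * q k) ^+ n))).
  rewrite !mulr_sumr; apply: ler_sum => k _.
  have /(_ (1 - theta * q k.+1)) := @subrXX_ge _ (1 - theta * q k) n (r0 k).
  rewrite lerD2l lerN2 ler_pM2l// qd => /(_ isT); apply: le_trans.
  have -> : 1 - theta * q k.+1 - (1 - theta * q k) = theta * (q k - q k.+1) by ring.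
  rewrite [theta * (n%:R * _)]mulrCA -!mulrA ler_wpM2l//.
  rewrite ler_wpM2l ?(ltW theta0)// ler_wpM2l ?subr_ge0//.
  by rewrite lerXn2r ?nnegrE.
rewrite -(big_mkord xpredT (fun k => (1 - theta * q k.+1) ^+ n - (1 - theta * q k) ^+ n)).
rewrite telescope_sumr//.
apply: (@le_trans _ _ ((1 - theta * q K) ^+ n)).
  by rewrite gerBl exprn_ge0.
by rewrite exprn_ile1// gerBl mulr_ge0// ltW.
Qed.

(** Mirror argument: [p k] is compared with the upper endpoint [1 - theta * q k.+1], where
    [subrXX_le] applies. *)
Lemma telescope_pow_ge p q theta n K : 0 < theta -> (0 < n)%N ->
    (forall k, 0 <= q k) -> (forall k, q k.+1 <= q k) ->
    (forall k, 0 <= 1 - theta * q k) -> (forall k, 1 - theta * q k.+1 <= p k) ->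
  theta^-1 * ((1 - theta * q K) ^+ n - (1 - theta * q 0%N) ^+ n) <=
  n%:R * (\sum_(k < K) (q k - q k.+1) * p k ^+ n.-1).
Proof.
move=> theta0 n0 q0 qd r0 pq; rewrite ler_pdivrMl//.
rewrite -(telescope_sumr (fun k => (1 - theta * q k) ^+ n))// big_mkord.
rewrite !mulr_sumr; apply: ler_sum => k _.
have /(_ (1 - theta * q k.+1)) := @subrXX_le _ (1 - theta * q k) n (r0 k).
rewrite lerD2l lerN2 ler_pM2l// qd => /(_ isT) /le_trans; apply.
have -> : 1 - theta * q k.+1 - (1 - theta * q k) = theta * (q k - q k.+1) by ring.
rewrite [theta * (n%:R * _)]mulrCA -!mulrA ler_wpM2l//.
rewrite ler_wpM2l ?(ltW theta0)// ler_wpM2l ?subr_ge0//.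
by rewrite lerXn2r ?nnegrE// (le_trans (r0 _) (pq k)).
Qed.

End telescoping.

(** * Auxiliary facts on limits and powers *)

Section limit.
Context {R : realType}.

Lemma cvg_squeeze_EFin (u : nat -> \bar R) (l : R) :
    (forall e, 0 < e -> \forall n \near \oo,
      ((l - e)%:E <= u n)%E /\ (u n <= (l + e)%:E)%E) ->
  u n @[n --> \oo] --> l%:E.
Proof.
move=> ul; apply/fine_cvgP; split.
  apply: filterS (ul 1 ltr01) => n [h1 h2].
  by rewrite fin_numE; apply/andP; split; apply/eqP => E; move: h1 h2; rewrite E.
apply/cvgrPdist_le => e e0; apply: filterS (ul e e0) => n /=.
case: (u n) => [r||] [] //; rewrite !lee_fin => h1 h2.
by rewrite distrC ler_distl h1 h2.
Qed.

(** Provides the ratio [lam] of the grid: the tail loss over one step, asymptotically [lam] to the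
    power [alpha], stays below [d]. *)
Lemma exists_powR_lt (alpha d : R) : 0 <= alpha -> 1 < d ->
  exists2 lam : R, 1 < lam & lam `^ alpha < d.
Proof.
move=> a0 d1.
have a1 : 0 < alpha + 1 by rewrite ltr_wpDl.
have d0 : 0 < d by exact: lt_trans d1.
have ld : 0 < ln d by rewrite ln_gt0.
(* The exponent of [d] becomes [alpha / (alpha + 1) < 1]; the added 1 covers [alpha = 0]. *)
exists (d `^ (alpha + 1)^-1).
  rewrite -[ltLHS](powRr0 d) /powR gt_eqF// ltr_expR mul0r mulr_gt0//.
  by rewrite invr_gt0.
rewrite -powRrM -[ltRHS]powRr1 ?(ltW d0)// /powR gt_eqF// ltr_expR ltr_pM2r//.
by rewrite mulrC ltr_pdivrMr// mul1r ltrDl.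
Qed.

End limit.

(** * Existence and value of the limit *)

Section laplace_limit.
Context {R : realType} d (T : measurableType d) (P : probability T R).
Variables (X : nat -> {RV P >-> R}) (F : R -> R) (alpha s : R).
Hypothesis alpha_ge0 : 0 <= alpha.
Hypothesis s_gt0 : 0 < s.
Hypothesis F_nonneg : nonneg_rv_cdf F.
Hypothesis F_rv : regularly_varying (- alpha) (fun x => 1 - F x).
Hypothesis X_iid : iid_with_cdf X F.

Let H := limit_denominator alpha s.
Let G x := 1 - F x.

Let G_anti : {homo G : x y / x <= y >-> y <= x}.
Proof. by move=> x y xy; rewrite lerD2l lerN2 (cdf_homo X_iid). Qed.

Let G_gt0 x : 0 < x -> 0 < G x. Proof. by case: F_rv => /(_ x). Qed.

Let G_le1 x : G x <= 1.
Proof. by rewrite gerBl; have /andP[] := cdf01 X_iid x. Qed.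

Let G_rv t : 0 < t -> G (t * x) / G x @[x --> +oo] --> t `^ (- alpha).
Proof. by case: F_rv => _ _ /(_ t). Qed.

Let G_cvg0 : G x @[x --> +oo] --> 0.
Proof.
have XF : (cdf (X 0%N) : R -> \bar R) = EFin \o F.
  by apply/funext => x; exact: X_iid.2.
have := cvg_cdfy1 (X 0%N); rewrite XF => /fine_cvg /= F1.
rewrite -(subrr (1 : R)).
by apply: cvgB => //; exact: cvg_cst.
Qed.

(** As [level s r <= 1], the integrand is at least 1. In particular [H] is positive. *)
Lemma limit_denominator_ge1 : (1 <= H)%E.
Proof.
have <- : (\int[@lebesgue_measure R]_(r in `]0%R, 1%R[) (cst 1%E r) = 1)%E.
  by rewrite integral_cst//= lebesgue_measure_itv/= lte_fin ltr01 sube0 mul1e.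
apply: ge0_le_integral => //.
- by apply/measurable_EFinP; apply: measurable_funTS; exact: measurable_level_powR.
- move=> r /=; rewrite in_itv/= => r01; rewrite lee_fin -(powRr0 (level s r)).
  by apply: ger_powR; rewrite ?level_gt0 ?level_le1// oppr_le0.
Qed.

(** * Bounds along the geometric grid of ratio [lam] *)

Section grid.
Variable lam : R.
Hypothesis lam_gt1 : 1 < lam.
Let b k := lam ^+ k.
Let q k := G (b k).
Let p k := trunc_laplace F s (b k).

Let b_gt0 k : 0 < b k. Proof. by rewrite exprn_gt0// (lt_trans ltr01). Qed.

Let b_homo : {homo b : m k / (m <= k)%N >-> m <= k}.
Proof. by move=> m k mk; rewrite ler_weXn2l// ltW. Qed.

Let b_cvg : b k @[k --> \oo] --> +oo.
Proof.
have lam1 : 0 < lam - 1 by rewrite subr_gt0.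
apply/cvgryPge => A; have := nbhs_infty_ger (A / (lam - 1)).
apply: filterS => k; rewrite ler_pdivrMr// => /le_trans; apply.
(* Bernoulli: [lam ^+ k - 1 >= k * (lam - 1)]. *)
have := subrXX_ge k ler01 (ltW lam_gt1); rewrite !expr1n mulr1 => /le_trans; apply.
by rewrite gerBl.
Qed.

Let q_gt0 k : 0 < q k. Proof. exact: G_gt0. Qed.

Let q_le k : q k.+1 <= q k. Proof. by apply: G_anti; exact: b_homo. Qed.

Let q_cvg : q k @[k --> \oo] --> 0.
Proof. exact: cvg_comp b_cvg G_cvg0. Qed.

Lemma grid_ratio_cvg : ((1 - p k) / q k)%:E @[k --> \oo] --> H.
Proof.
have := cvg_tail_integral alpha_ge0 G_anti G_gt0 G_le1 G_rv s_gt0 b_gt0 b_cvg.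
apply: cvg_trans; apply: near_eq_cvg; apply: nearW => k /=.
under eq_integral do rewrite EFinM muleC.
rewrite ge0_integralZl_EFin ?invr_ge0 ?(ltW (q_gt0 _))//.
- by rewrite (integral_tail_level s_gt0 X_iid)// -EFinM mulrC.
- by move=> r _; rewrite lee_fin subr_ge0; have /andP[] := cdf01 X_iid (b k * level s r).
- apply/measurable_EFinP; apply: measurable_funTS.
  apply: (measurableT_comp (nonincreasing_measurable measurableT G_anti)).
  by apply: measurable_funM => //; exact: measurable_level.
Qed.

Lemma grid_step_le (dlt : R) : lam `^ alpha < dlt ->
  \forall k \near \oo, q k <= dlt * q k.+1.
Proof.
move=> ld; have dlt0 : 0 < dlt by apply: le_lt_trans ld; exact: powR_ge0.
have lam0 : 0 < lam by exact: lt_trans lam_gt1.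
have := cvg_comp _ _ b_cvg (G_rv lam0).
move=> /cvgr_gt /(_ dlt^-1) []; first by rewrite powRN ltf_pV2 ?posrE ?powR_gt0.
move=> N _ NP; exists N => // k Nk; have := NP k Nk.
rewrite /= ltr_pdivlMr ?q_gt0// -exprS mulrC ltr_pdivrMr// => /ltW.
by rewrite mulrC.
Qed.

(** Starting the grid at a large [k0] makes both eventual hypotheses hold at every index; maxima at
    most [b k0] cost [f ^+ n] with [f = F (b k0)]. *)
Lemma laplace_le_grid (theta dlt : R) : 0 < theta -> 0 < dlt ->
    (\forall k \near \oo, theta * q k <= 1 - p k) ->
    (\forall k \near \oo, q k <= dlt * q k.+1) ->
  exists2 f : R, 0 <= f < 1 & forall n, (0 < n)%N ->
    (laplace P (sum_max_ratio X n) s <= (f ^+ n + expR (- s) * (dlt / theta))%:E)%E.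
Proof.
move=> theta0 dlt0 [N1 _ pN1] [N2 _ qN2]; pose k0 := maxn N1 N2.
exists (F (b k0)).
  have /andP[-> _] := cdf01 X_iid (b k0); rewrite /=.
  by rewrite -subr_gt0; exact: q_gt0.
move=> n n0.
pose b' k := b (k + k0)%N; pose q' k := q (k + k0)%N; pose p' k := p (k + k0)%N.
have bound K : (laplace P (sum_max_ratio X n) s <=
    (F (b k0) ^+ n + (n%:R * q' K + expR (- s) * (dlt / theta)))%:E)%E.
  have /(_ n K) := @laplace_le _ _ _ _ X F s s_gt0 X_iid F_nonneg b' _ _ _.
  move=> /(_ (b_gt0 _) _ n0) le1; apply: (le_trans (le1 _)) => [m k mk|].
    by apply: b_homo; rewrite leq_add2r.
  rewrite lee_fin lerD2l lerD2l mulrCA ler_wpM2l ?expR_ge0//.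
  have -> : \sum_(k < K) (F (b' k.+1) - F (b' k)) * trunc_laplace F s (b' k.+1) ^+ n.-1 =
     \sum_(k < K) (q' k - q' k.+1) * p' k.+1 ^+ n.-1.
    apply: eq_bigr => k _; congr (_ * _); rewrite /q' /q /G /b'; ring.
  (* The constant is [theta / dlt], as [1 - p k.+1 >= theta * q k.+1 >= (theta / dlt) * q k]. *)
  rewrite -invf_div; apply: telescope_pow_le => //.
  - by rewrite divr_gt0.
  - by move=> k; rewrite ltW// q_gt0.
  - by move=> k; exact: q_le.
  - by move=> k; have /andP[] := trunc_laplace01 s_gt0 X_iid (b_gt0 (k + k0)).
  - move=> k; rewrite lerBrDr -lerBrDl.
    have h1 : (N1 <= k.+1 + k0)%N by rewrite /k0; lia.
    have h2 : (N2 <= k + k0)%N by rewrite /k0; lia.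
    apply: le_trans (pN1 _ h1); rewrite mulrAC ler_pdivrMr// -mulrA ler_wpM2l ?(ltW theta0)//.
    by rewrite mulrC; exact: qN2.
(* Here [n] is fixed: a large [K] makes [n%:R * q' K] at most [e]. *)
apply/lee_addgt0Pr => e e0.
have en : 0 < e / n%:R by rewrite divr_gt0// ltr0n.
have [N _ NP] := cvgr_lt _ q_cvg _ en.
apply: (le_trans (bound N)); rewrite -EFinD lee_fin -[leRHS]addrA lerD2l [leRHS]addrC lerD2r.
rewrite mulrC -ler_pdivlMr ?ltr0n// ltW//; apply: NP => /=; lia.
Qed.

(** Mirror of [laplace_le_grid] with constant [t = dlt * theta], since
    [1 - p k <= theta * q k <= t * q k.+1]. *)
Lemma laplace_ge_grid (theta dlt : R) : 0 < theta -> 0 < dlt ->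
    (\forall k \near \oo, 1 - p k <= theta * q k) ->
    (\forall k \near \oo, q k <= dlt * q k.+1) ->
  exists2 f : R, 0 <= f < 1 & forall n, (0 < n)%N ->
    ((expR (- s) * (1 - f ^+ n) / (dlt * theta))%:E <= laplace P (sum_max_ratio X n) s)%E.
Proof.
move=> theta0 dlt0 [N1 _ pN1] [N2 _ qN2].
set t := dlt * theta; have t0 : 0 < t by rewrite mulr_gt0.
have tV0 : 0 < t^-1 by rewrite invr_gt0.
(* A third threshold ensures [t * q k < 1], so that the telescoped powers have nonnegative bases. *)
have [N3 _ qN3] := cvgr_lt _ q_cvg _ tV0.
pose k0 := maxn N1 (maxn N2 N3).
have tq k : 0 <= 1 - t * q (k + k0)%N.
  rewrite subr_ge0 mulrC -ler_pdivlMr// mul1r ltW//; apply: qN3.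
  by rewrite /= /k0; lia.
exists (1 - t * q k0).
  by rewrite (tq 0%N)/= ltrBlDr ltrDl mulr_gt0// q_gt0.
move=> n n0.
pose b' k := b (k + k0)%N; pose q' k := q (k + k0)%N; pose p' k := p (k + k0)%N.
have bound K : ((expR (- s) * (t^-1 * ((1 - t * q' K) ^+ n - (1 - t * q k0) ^+ n)))%:E <=
    laplace P (sum_max_ratio X n) s)%E.
  have /(_ n K) := @laplace_ge _ _ _ _ X F s s_gt0 X_iid F_nonneg b' _ _ _.
  move=> /(_ (b_gt0 _) _ n0) le1; apply: (le_trans _ (le1 _)) => [|m k mk]; last first.
    by apply: b_homo; rewrite leq_add2r.
  rewrite lee_fin [leRHS]mulrCA ler_wpM2l ?expR_ge0//.
  have -> : \sum_(k < K) (F (b' k.+1) - F (b' k)) * trunc_laplace F s (b' k) ^+ n.-1 =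
     \sum_(k < K) (q' k - q' k.+1) * p' k ^+ n.-1.
    apply: eq_bigr => k _; congr (_ * _); rewrite /q' /q /G /b'; ring.
  apply: (@telescope_pow_ge _ p' q') => //.
  - by move=> k; rewrite ltW// q_gt0.
  - by move=> k; exact: q_le.
  - move=> k; rewrite lerBlDr -lerBlDl.
    have h1 : (N1 <= k + k0)%N by rewrite /k0; lia.
    have h2 : (N2 <= k + k0)%N by rewrite /k0; lia.
    apply: (le_trans (pN1 _ h1)); rewrite /t mulrAC [leRHS]mulrC ler_wpM2l ?(ltW theta0)//.
    exact: qN2.
apply/lee_addgt0Pr => e e0.
have en : 0 < e / n%:R by rewrite divr_gt0// ltr0n.
have [N _ NP] := cvgr_lt _ q_cvg _ en.
rewrite -leeBlDr//; apply: (le_trans _ (bound N)); rewrite -EFinB lee_fin.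
have qe : n%:R * q' N <= e.
  by rewrite mulrC -ler_pdivlMr ?ltr0n// ltW//; apply: NP => /=; lia.
(* The missing part [1 - (1 - t * q' N) ^+ n] is at most [n%:R * (t * q' N)]. *)
have := @subrXX_le _ 1 (1 - t * q' N) n (tq N).
rewrite !expr1n mulr1 subKr gerBl mulr_ge0 ?(ltW t0) ?(ltW (q_gt0 _))// => /(_ isT) h.
rewrite lerBlDr -lerBlDl -mulrA [_ / t]mulrC -mulrBr -mulrBr.
apply: (le_trans _ qe); rewrite mulrA opprB addrA subrK.
have t0' : 0 <= expR (- s) / t by rewrite divr_ge0 ?expR_ge0 ?ltW.
apply: (le_trans (ler_wpM2l t0' h)).
have -> : expR (- s) / t * (n%:R * (t * q' N)) = expR (- s) * (n%:R * q' N).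
  by field; rewrite gt_eqF.
rewrite ger_pMl ?mulr_gt0 ?ltr0n ?q_gt0//.
by rewrite -[leRHS]expR0 ler_expR oppr_le0 ltW.
Qed.

End grid.

Lemma laplace_eventually_le (theta c : R) : 0 < theta -> (theta%:E < H)%E ->
    expR (- s) / theta < c ->
  \forall n \near \oo, (laplace P (sum_max_ratio X n) s <= c%:E)%E.
Proof.
move=> theta0 thetaH ec.
(* This midpoint keeps [expR (- s) * (dlt / theta)] strictly below [c], leaving room for
   [f ^+ n]. *)
pose dlt := (1 + c * theta / expR (- s)) / 2.
have es := expR_gt0 (- s).
have r1 : 1 < c * theta / expR (- s).
  by rewrite ltr_pdivlMr// mul1r -ltr_pdivrMr.
have dlt1 : 1 < dlt by rewrite midf_lt.
have dltc : expR (- s) * (dlt / theta) < c.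
  by rewrite mulrA ltr_pdivrMr// mulrC -ltr_pdivlMr// midf_lt.
have [lam lam1 lamd] := exists_powR_lt alpha_ge0 dlt1.
have [] := @laplace_le_grid lam lam1 theta dlt theta0.
- exact: lt_trans dlt1.
- have : \forall k \near \oo, (theta%:E < ((1 - trunc_laplace F s (lam ^+ k)) / G (lam ^+ k))%:E)%E.
    exact: (grid_ratio_cvg lam1 (open_nbhs_nbhs (conj (@open_ereal_gt_ereal _ _) thetaH))).
  apply: filterS => k /=; rewrite lte_fin ltr_pdivlMr; first exact: ltW.
  by rewrite G_gt0// exprn_gt0// (lt_trans ltr01).
- exact: grid_step_le.
move=> f /andP[f0 f1] bound.
have fn : f ^+ n @[n --> \oo] --> 0 by apply: cvg_expr; rewrite ger0_norm.
have ce : 0 < c - expR (- s) * (dlt / theta) by rewrite subr_gt0.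
near=> n; have n0 : (0 < n)%N by near: n; exact: nbhs_infty_gt.
have fc : f ^+ n < c - expR (- s) * (dlt / theta) by near: n; exact: (cvgr_lt _ fn _ ce).
apply: (le_trans (bound n n0)); rewrite lee_fin.
by rewrite -lerBrDr ltW.
Unshelve. all: by end_near. Qed.

Lemma laplace_eventually_ge (theta c : R) : 0 < theta -> (H < theta%:E)%E ->
    c < expR (- s) / theta ->
  \forall n \near \oo, (c%:E <= laplace P (sum_max_ratio X n) s)%E.
Proof.
move=> theta0 thetaH ec.
pose l := expR (- s) / theta.
have es := expR_gt0 (- s).
have [c0|c0] := leP c 0.
  apply: nearW => n; apply: (@le_trans _ _ 0%E); first by rewrite lee_fin.
  by apply: expectation_ge0 => w; exact: expR_ge0.
pose dlt := (1 + l / c) / 2.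
have lc : 1 < l / c by rewrite ltr_pdivlMr// mul1r.
have dlt1 : 1 < dlt by rewrite midf_lt.
have dltl : dlt < l / c by rewrite midf_lt.
have dlt0 : 0 < dlt by exact: lt_trans dlt1.
have cl : c < expR (- s) / (dlt * theta).
  have -> : expR (- s) / (dlt * theta) = l / dlt by rewrite /l; field; rewrite !gt_eqF.
  by rewrite ltr_pdivlMr// mulrC -ltr_pdivlMr.
have [lam lam1 lamd] := exists_powR_lt alpha_ge0 dlt1.
have [] := @laplace_ge_grid lam lam1 theta dlt theta0 dlt0.
- have : \forall k \near \oo, (((1 - trunc_laplace F s (lam ^+ k)) / G (lam ^+ k))%:E < theta%:E)%E.
    exact: (grid_ratio_cvg lam1 (open_nbhs_nbhs (conj (@open_ereal_lt_ereal _ _) thetaH))).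
  apply: filterS => k /=; rewrite lte_fin ltr_pdivrMr; first exact: ltW.
  by rewrite G_gt0// exprn_gt0// (lt_trans ltr01).
- exact: grid_step_le.
move=> f /andP[f0 f1] bound; set u := expR (- s) / (dlt * theta) in cl.
have u0 : 0 < u by exact: lt_trans cl.
have fn : f ^+ n @[n --> \oo] --> 0 by apply: cvg_expr; rewrite ger0_norm.
have ce : 0 < 1 - c / u by rewrite subr_gt0 ltr_pdivrMr// mul1r.
near=> n; have n0 : (0 < n)%N by near: n; exact: nbhs_infty_gt.
have fc : f ^+ n < 1 - c / u by near: n; exact: (cvgr_lt _ fn _ ce).
apply: (le_trans _ (bound n n0)); rewrite lee_fin.
rewrite mulrAC -/u mulrC -ler_pdivrMr// lerBrDr -lerBrDl.
exact: ltW.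
Unshelve. all: by end_near. Qed.

(* If H = +oo then fine H = 0 and the quotient is 0, which is the right limit. *)
Lemma cvg_laplace : laplace P (sum_max_ratio X n) s @[n --> \oo] -->
  (expR (- s) / fine H)%:E.
Proof.
have es := expR_gt0 (- s); apply: cvg_squeeze_EFin => e e0.
have e2 : e / 2 < e by rewrite ltr_pdivrMr// ltr_pMr// ltr1n.
have e20 : 0 < e / 2 by rewrite divr_gt0.
have ge0 n : (0 <= laplace P (sum_max_ratio X n) s)%E.
  by apply: expectation_ge0 => w; exact: expR_ge0.
have := limit_denominator_ge1; move EH : H => h; case: h EH => [h| |] EH //.
  rewrite lee_fin => h1 /=; have h0 : 0 < h by exact: lt_le_trans h1.
  have l0 : 0 < expR (- s) / h by rewrite divr_gt0.
  set l := expR (- s) / h in l0 *.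
  have lE : h = expR (- s) / l by rewrite /l; field; rewrite !gt_eqF.
  have lo : \forall n \near \oo, ((l - e)%:E <= laplace P (sum_max_ratio X n) s)%E.
    (* If [l - e / 2 <= 0] it yields no positive [theta], but then [l - e <= 0] and the bound is
       trivial. *)
    have [le0|le0] := leP (l - e / 2) 0.
      apply: nearW => n; apply: le_trans (ge0 n); rewrite lee_fin.
      by apply: le_trans le0; rewrite lerD2l lerN2 ltW.
    apply: (@laplace_eventually_ge (expR (- s) / (l - e / 2))).
    - by rewrite divr_gt0.
    - rewrite EH lte_fin lE ltr_pM2l// ltf_pV2 ?posrE// gtrBl//.
    - by rewrite invf_div mulrCA divff ?gt_eqF// mulr1 ltrD2l ltrN2.
  have hi : \forall n \near \oo, (laplace P (sum_max_ratio X n) s <= (l + e)%:E)%E.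
    have le0 : 0 < l + e / 2 by rewrite addr_gt0.
    apply: (@laplace_eventually_le (expR (- s) / (l + e / 2))).
    - by rewrite divr_gt0.
    - by rewrite EH lte_fin lE ltr_pM2l// ltf_pV2 ?posrE// ltrDl.
    - by rewrite invf_div mulrCA divff ?gt_eqF// mulr1 ltrD2l.
  by near=> n; split; [near: n; exact: lo|near: n; exact: hi].
move=> _ /=; rewrite invr0 mulr0 sub0r add0r.
(* Every finite [theta] is below [H]; the one chosen gives [e / 2 < e]. *)
have hi : \forall n \near \oo, (laplace P (sum_max_ratio X n) s <= e%:E)%E.
  apply: (@laplace_eventually_le (expR (- s) / (e / 2))).
  - by rewrite divr_gt0.
  - by rewrite EH ltry.
  - by rewrite invf_div mulrCA divff ?gt_eqF// mulr1.
apply: filterS hi => n hn; split => //.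
by apply: le_trans (ge0 n); rewrite lee_fin oppr_le0 ltW.
Unshelve. all: by end_near. Qed.

End laplace_limit.

(** * Comparison of the two limits *)

Lemma le_limit_denominator (R : realType) (alpha1 alpha2 s : R) : 0 < s ->
  alpha1 <= alpha2 -> (limit_denominator alpha1 s <= limit_denominator alpha2 s)%E.
Proof.
move=> s0 a12; apply: ge0_le_integral => //.
- by move=> r _; rewrite lee_fin powR_ge0.
- by apply/measurable_EFinP; apply: measurable_funTS; exact: measurable_level_powR.
- by apply/measurable_EFinP; apply: measurable_funTS; exact: measurable_level_powR.
- move=> r /=; rewrite in_itv/= => r01; rewrite lee_fin; apply: ger_powR.
    by rewrite level_gt0// level_le1.
  by rewrite lerN2.
Qed.

Theorem theorem1 (R : realType) (alpha1 alpha2 : R) (F1 F2 : R -> R)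
    (d1 : measure_display) (T1 : measurableType d1) (P1 : probability T1 R)
    (X1 : nat -> {RV P1 >-> R})
    (d2 : measure_display) (T2 : measurableType d2) (P2 : probability T2 R)
    (X2 : nat -> {RV P2 >-> R})
    (alpha1_ge0 : 0 <= alpha1) (alpha2_ge0 : 0 <= alpha2)
    (F1_cdf : nonneg_rv_cdf F1) (F2_cdf : nonneg_rv_cdf F2)
    (F1_tail : regularly_varying (- alpha1) (fun x => 1 - F1 x))
    (F2_tail : regularly_varying (- alpha2) (fun x => 1 - F2 x))
    (X1_iid : iid_with_cdf X1 F1) (X2_iid : iid_with_cdf X2 F2)
    (alpha12 : alpha1 <= alpha2) :
  forall s : R, 0 < s ->
    exists l1 l2 : R,
      [/\ laplace P1 (sum_max_ratio X1 n) s @[n --> \oo] --> l1%:E,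
          laplace P2 (sum_max_ratio X2 n) s @[n --> \oo] --> l2%:E &
          l2 <= l1].
Proof.
move=> s s0; exists (expR (- s) / fine (limit_denominator alpha1 s)).
exists (expR (- s) / fine (limit_denominator alpha2 s)).
split; [exact: (cvg_laplace (F := F1))|exact: (cvg_laplace (F := F2))|].
have H1 := limit_denominator_ge1 alpha1_ge0 s0.
have H12 := le_limit_denominator s0 alpha12.
have H2 := le_trans H1 H12.
rewrite ler_wpM2l ?expR_ge0//; move: H1 H2 H12.
case: (limit_denominator alpha1 s) => [h1| |] //.
  case: (limit_denominator alpha2 s) => [h2| |] //=; rewrite !lee_fin.
    move=> h1_ge1 h2_ge1 h12.
    by rewrite lef_pV2 ?posrE// (lt_le_trans ltr01).
  (* If only [H(alpha2)] is infinite, [fine] and the inverse default to 0. *)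
  by move=> h1_ge1 _ _; rewrite invr0 invr_ge0 (le_trans ler01).
(* An infinite [H(alpha1)] forces [H(alpha2)] to be infinite, and both limits are 0. *)
by case: (limit_denominator alpha2 s).
Qed.
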